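(* Define recursively, backward in $t=T-1,\dots,0$, starting from $a_T^+=a_T^-=b_T^+=b_T^-=0$: $\mathbf K_t^+\in\arg\min_{\mathbf K\in\mathbb R^n}F_t^+(\mathbf K)$, $\mathbf K_t^-\in\arg\min_{\mathbf K\in\mathbb R^n}F_t^-(\mathbf K)$ (with $F_t^\pm$ built from $a_{t+1}^\pm,b_{t+1}^\pm$), and $$a_t^+=\rho_{t+1}\mathbb E[\mathbf P_t]'\mathbf K_t^++\mathbb E[a_{t+1}^+Z_t^+1_{\{Z_t^+\ge0\}}]+\mathbb E[a_{t+1}^-Z_t^+1_{\{Z_t^+<0\}}],$$ $$a_t^-=\rho_{t+1}\mathbb E[\mathbf P_t]'\mathbf K_t^-+\mathbb E[a_{t+1}^+Z_t^-1_{\{Z_t^-\le0\}}]+\mathbb E[a_{t+1}^-Z_t^-1_{\{Z_t^->0\}}],$$ $$b_t^+=\rho_{t+1}^2(\mathbf K_t^+)'\mathbb E[\mathbf P_t\mathbf P_t']\mathbf K_t^++2\rho_{t+1}\mathbb E[a_{t+1}^+Z_t^+\mathbf P_t'\mathbf K_t^+1_{\{Z_t^+\ge0\}}]+2\rho_{t+1}\mathbb E[a_{t+1}^-Z_t^+\mathbf P_t'\mathbf K_t^+1_{\{Z_t^+<0\}}]+\mathbb E[b_{t+1}^+(Z_t^+)^21_{\{Z_t^+\ge0\}}]+\mathbb E[b_{t+1}^-(Z_t^+)^21_{\{Z_t^+<0\}}],$$ $$b_t^-=\rho_{t+1}^2(\mathbf K_t^-)'\mathbb E[\mathbf P_t\mathbf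 P_t']\mathbf K_t^-+2\rho_{t+1}\mathbb E[a_{t+1}^+Z_t^-\mathbf P_t'\mathbf K_t^-1_{\{Z_t^-\le0\}}]+2\rho_{t+1}\mathbb E[a_{t+1}^-Z_t^-\mathbf P_t'\mathbf K_t^-1_{\{Z_t^->0\}}]+\mathbb E[b_{t+1}^+(Z_t^-)^21_{\{Z_t^-\le0\}}]+\mathbb E[b_{t+1}^-(Z_t^-)^21_{\{Z_t^->0\}}],$$ where $Z_t^\pm=s_t+\mathbf P_t'\mathbf K_t^\pm$. Then these quantities are well defined (the minimizers exist), $b_t^+-(a_t^+)^2\ge0$ and $b_t^--(a_t^-)^2\ge0$ for all $t$, and the time consistent behavioral portfolio policy of the nested problem is, for $t=0,\dots,T-1$, $$\mathbf u_t^{TC}=\mathbf K_t^+(X_t-\rho_t^{-1}W)1_{\{X_t\ge\rho_t^{-1}W\}}+\mathbf K_t^-(X_t-\rho_t^{-1}W)1_{\{X_t<\rho_t^{-1}W\}}.$$ Moreover, the mean and variance of the terminal wealth under this policy are $$\mathbb E[X_T\mid X_0]=\rho_0X_0+a_0^+(X_0-\rho_0^{-1}W)1_{\{X_0\ge\rho_0^{-1}W\}}+a_0^-(X_0-\rho_0^{-1}W)1_{\{X_0<\rho_0^{-1}W\}},$$ $$\mathrm{Var}(X_T\mid X_0)=\Big[(b_0^+-(a_0^+)^2)1_{\{X_0\ge\rho_0^{-1}W\}}+(b_0^--(a_0^-)^2)1_{\{X_0<\rho_0^{-1}W\}}\Big](X_0-\rho_0^{-1}W)^2.$$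
   Context: Market: $T$ periods, one risk-free asset with deterministic gross return $s_t>1$ in period $t$, and $n$ risky assets with random gross return vector $\mathbf e_t$ in period $t$. The excess return vector is $\mathbf P_t=\mathbf e_t-s_t\mathbf 1\in\mathbb R^n$. The vectors $\mathbf P_0,\dots,\mathbf P_{T-1}$ are statistically independent, absolutely continuous, with finite first and second moments, and each covariance matrix $\mathrm{Cov}(\mathbf P_t)=\mathbb E[\mathbf P_t\mathbf P_t']-\mathbb E[\mathbf P_t]\mathbb E[\mathbf P_t]'$ is positive definite. The market is arbitrage-free; in particular, for every nonzero $\mathbf L\in\mathbb R^n$, neither $\mathbf P_t'\mathbf L\le 0$ a.s. nor $\mathbf P_t'\mathbf L\ge 0$ a.s. holds. Write $\rho_t=\prod_{j=t}^{T-1}s_j$ for $t<T$ and $\rho_T=1$. Wealth dynamics: $X_{t+1}=s_tX_t+\mathbf P_t'\mathbf u_t$, where $\mathbf u_t\in\mathbb R^n$ (amounts in risky assets) is a Markov feedback policy, i.e. a deterministic function of the current wealth $X_t$. An investment target $W\in\mathbb R$ is fixed. Behavioral risk aversion: for constants $\gamma_t^+,\gamma_t^-\ge0$, $\gamma_t(X_t)=\gamma_t^+(X_t-\rho_t^{-1}W)$ if $X_t\ge\rho_t^{-1}W$, and $\gamma_t(X_t)=-\gamma_t^-(X_t-\rho_t^{-1}W)$ if $X_t<\rho_t^{-1}W$. Time consistent policy (nested mean-variance problem): a Markov policy $(\mathbf u_0^{TC},\dots,\mathbf u_{T-1}^{TC})$ is time consistent if for every $t$ and every wealth level $X_t$,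 $\mathbf u_t^{TC}(X_t)$ minimizes over $\mathbf u_t\in\mathbb R^n$ the objective $\mathrm{Var}(X_T\mid X_t)-\gamma_t(X_t)\mathbb E[X_T\mid X_t]$, where $X_{t+1}=s_tX_t+\mathbf P_t'\mathbf u_t$ and $X_{j+1}=s_jX_j+\mathbf P_j'\mathbf u_j^{TC}(X_j)$ for $j=t+1,\dots,T-1$. Definition of $F_t^\pm:\mathbb R^n\to\mathbb R$, given deterministic numbers $a_{t+1}^\pm,b_{t+1}^\pm,\gamma_t^\pm$, writing $Z=s_t+\mathbf P_t'\mathbf K$: $$F_t^+(\mathbf K)=\rho_{t+1}^2\mathbf K'\mathrm{Cov}(\mathbf P_t)\mathbf K+\mathbb E\big[(2\rho_{t+1}a_{t+1}^++b_{t+1}^+)Z^21_{\{Z\ge0\}}\big]+\mathbb E\big[(2\rho_{t+1}a_{t+1}^-+b_{t+1}^-)Z^21_{\{Z<0\}}\big]-M_+^2-2\rho_{t+1}M_+\,(s_t+\mathbb E[\mathbf P_t]'\mathbf K)-\gamma_t^+M_+-\rho_{t+1}\gamma_t^+(s_t+\mathbb E[\mathbf P_t]'\mathbf K),$$ where $M_+=\mathbb E[a_{t+1}^+Z1_{\{Z\ge0\}}]+\mathbb E[a_{t+1}^-Z1_{\{Z<0\}}]$; and $$F_t^-(\mathbf K)=\rho_{t+1}^2\mathbf K'\mathrm{Cov}(\mathbf P_t)\mathbf K+\mathbb E\big[(2\rho_{t+1}a_{t+1}^++b_{t+1}^+)Z^21_{\{Z\le0\}}\big]+\mathbb E\big[(2\rho_{t+1}a_{t+1}^-+b_{t+1}^-)Z^21_{\{Z>0\}}\big]-M_-^2-2\rho_{t+1}M_-\,(s_t+\mathbb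 E[\mathbf P_t]'\mathbf K)+\gamma_t^-M_-+\rho_{t+1}\gamma_t^-(s_t+\mathbb E[\mathbf P_t]'\mathbf K),$$ where $M_-=\mathbb E[a_{t+1}^+Z1_{\{Z\le0\}}]+\mathbb E[a_{t+1}^-Z1_{\{Z>0\}}]$. *)

(* Defs.v *)
From HB Require Import structures.
From mathcomp Require Import all_boot all_order all_algebra.
From mathcomp Require Import all_classical all_reals all_analysis.

Set Implicit Arguments.
Unset Strict Implicit.
Unset Printing Implicit Defensive.

Import Order.TTheory GRing.Theory Num.Theory.
Local Open Scope classical_set_scope.
Local Open Scope ring_scope.

Section Market.
Context {d : measure_display} {Omega : measurableType d} {R : realType}.
Variable (P : probability Omega R).
Variable (n : nat).

(* Real-valued expectation (all expectations used below are of integrable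
   functions under the standing assumptions). *)
Definition Ex (X : Omega -> R) : R := fine ('E_P[X])%E.

(* ---- the excess returns: Pc t i w = i-th coordinate of P_t(w) ---- *)
Variable Pc : nat -> 'I_n -> Omega -> R.

Definition vecP (t : nat) (w : Omega) : 'rV[R]_n := \row_i Pc t i w.

Definition pK (t : nat) (K : 'rV[R]_n) (w : Omega) : R :=
  \sum_(i < n) Pc t i w * K ord0 i.

Definition meanP (t : nat) : 'rV[R]_n := \row_i Ex (Pc t i).
Definition secondP (t : nat) : 'M[R]_n :=
  \matrix_(i, j) Ex (fun w => Pc t i w * Pc t j w).
Definition covP (t : nat) : 'M[R]_n := secondP t - (meanP t)^T *m meanP t.

Definition quad (M : 'M[R]_n) (K : 'rV[R]_n) : R := (K *m M *m K^T) ord0 ord0.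
Definition meanK (t : nat) (K : 'rV[R]_n) : R := (meanP t *m K^T) ord0 ord0.

Definition sigmaP (t : nat) : set (set Omega) :=
  <<s [set A | exists i B, measurable B /\ A = Pc t i @^-1` B] >>.

Definition indep_returns (N : nat) : Prop :=
  forall A : nat -> set Omega, (forall t, (t < N)%N -> sigmaP t (A t)) ->
  P (\bigcap_(t in [set t | (t < N)%N]) A t) = (\prod_(t < N) P (A t))%E.

Definition box (a b : 'rV[R]_n) : set 'rV[R]_n :=
  [set x | forall i, a ord0 i <= x ord0 i <= b ord0 i].
Definition boxvol (a b : 'rV[R]_n) : R := \prod_(i < n) (b ord0 i - a ord0 i).

Definition leb_null (Nset : set 'rV[R]_n) : Prop :=
  forall e : R, 0 < e -> exists a b : nat -> 'rV[R]_n,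
    (forall k i, a k ord0 i <= b k ord0 i) /\
    Nset `<=` \bigcup_k box (a k) (b k) /\
    (forall m, \sum_(k < m) boxvol (a k) (b k) <= e).

Definition abs_cont (t : nat) : Prop :=
  forall Nset, leb_null Nset -> P.-negligible [set w | Nset (vecP t w)].

Definition market_assumptions (N : nat) (s : nat -> R) : Prop :=
  [/\ forall t, (t < N)%N -> 1 < s t,
      forall t i, (t < N)%N -> measurable_fun setT (Pc t i),
      forall t i, (t < N)%N ->
        P.-integrable setT (EFin \o Pc t i) /\
        P.-integrable setT (EFin \o (fun w => Pc t i w ^+ 2)),
      indep_returns N &
      [/\ forall t, (t < N)%N -> abs_cont t,
          forall t, (t < N)%N -> forall K : 'rV[R]_n, K != 0 -> 0 < quad (covP t) K
        & forall t, (t < N)%N -> forall L : 'rV[R]_n, L != 0 ->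
            ~ {ae P, forall w, pK t L w <= 0} /\
            ~ {ae P, forall w, 0 <= pK t L w}]].

Variables (N : nat) (s : nat -> R) (W : R) (gp gm : nat -> R).

Definition rho (t : nat) : R := \prod_(t <= j < N) s j.

Definition lvl (t : nat) : R := (rho t)^-1 * W.

Definition gam (t : nat) (x : R) : R :=
  if lvl t <= x then gp t * (x - lvl t) else - (gm t * (x - lvl t)).

Section F.
Variables (t : nat) (ap am bp bm : R). (* a_{t+1}^+, a_{t+1}^-, b_{t+1}^+, b_{t+1}^- *)

Definition Zt (K : 'rV[R]_n) (w : Omega) : R := s t + pK t K w.

Definition Mplus (K : 'rV[R]_n) : R :=
  Ex (fun w => if 0 <= Zt K w then ap * Zt K w else 0) +
  Ex (fun w => if Zt K w < 0 then am * Zt K w else 0).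

Definition Fplus (K : 'rV[R]_n) : R :=
  (rho t.+1) ^+ 2 * quad (covP t) K
  + Ex (fun w => if 0 <= Zt K w then (2 * rho t.+1 * ap + bp) * Zt K w ^+ 2 else 0)
  + Ex (fun w => if Zt K w < 0 then (2 * rho t.+1 * am + bm) * Zt K w ^+ 2 else 0)
  - Mplus K ^+ 2
  - 2 * rho t.+1 * Mplus K * (s t + meanK t K)
  - gp t * Mplus K
  - rho t.+1 * gp t * (s t + meanK t K).

Definition Mminus (K : 'rV[R]_n) : R :=
  Ex (fun w => if Zt K w <= 0 then ap * Zt K w else 0) +
  Ex (fun w => if 0 < Zt K w then am * Zt K w else 0).

Definition Fminus (K : 'rV[R]_n) : R :=
  (rho t.+1) ^+ 2 * quad (covP t) K
  + Ex (fun w => if Zt K w <= 0 then (2 * rho t.+1 * ap + bp) * Zt K w ^+ 2 else 0)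
  + Ex (fun w => if 0 < Zt K w then (2 * rho t.+1 * am + bm) * Zt K w ^+ 2 else 0)
  - Mminus K ^+ 2
  - 2 * rho t.+1 * Mminus K * (s t + meanK t K)
  + gm t * Mminus K
  + rho t.+1 * gm t * (s t + meanK t K).

Definition a_plus (K : 'rV[R]_n) : R :=
  rho t.+1 * meanK t K
  + Ex (fun w => if 0 <= Zt K w then ap * Zt K w else 0)
  + Ex (fun w => if Zt K w < 0 then am * Zt K w else 0).

Definition a_minus (K : 'rV[R]_n) : R :=
  rho t.+1 * meanK t K
  + Ex (fun w => if Zt K w <= 0 then ap * Zt K w else 0)
  + Ex (fun w => if 0 < Zt K w then am * Zt K w else 0).

Definition b_plus (K : 'rV[R]_n) : R :=
  (rho t.+1) ^+ 2 * quad (secondP t) K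
  + 2 * rho t.+1 * Ex (fun w => if 0 <= Zt K w then ap * Zt K w * pK t K w else 0)
  + 2 * rho t.+1 * Ex (fun w => if Zt K w < 0 then am * Zt K w * pK t K w else 0)
  + Ex (fun w => if 0 <= Zt K w then bp * Zt K w ^+ 2 else 0)
  + Ex (fun w => if Zt K w < 0 then bm * Zt K w ^+ 2 else 0).

Definition b_minus (K : 'rV[R]_n) : R :=
  (rho t.+1) ^+ 2 * quad (secondP t) K
  + 2 * rho t.+1 * Ex (fun w => if Zt K w <= 0 then ap * Zt K w * pK t K w else 0)
  + 2 * rho t.+1 * Ex (fun w => if 0 < Zt K w then am * Zt K w * pK t K w else 0)
  + Ex (fun w => if Zt K w <= 0 then bp * Zt K w ^+ 2 else 0)
  + Ex (fun w => if 0 < Zt K w then bm * Zt K w ^+ 2 else 0).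
End F.

Definition is_argmin (F : 'rV[R]_n -> R) (K : 'rV[R]_n) : Prop :=
  forall K' : 'rV[R]_n, F K <= F K'.

Definition recursion_from (t0 : nat) (Kp Km : nat -> 'rV[R]_n)
    (ap am bp bm : nat -> R) : Prop :=
  [/\ ap N = 0, am N = 0, bp N = 0, bm N = 0 &
    forall t, (t0 <= t < N)%N ->
      [/\ is_argmin (Fplus t (ap t.+1) (am t.+1) (bp t.+1) (bm t.+1)) (Kp t),
          is_argmin (Fminus t (ap t.+1) (am t.+1) (bp t.+1) (bm t.+1)) (Km t) &
       [/\ ap t = a_plus t (ap t.+1) (am t.+1) (Kp t),
          am t = a_minus t (ap t.+1) (am t.+1) (Km t),
          bp t = b_plus t (ap t.+1) (am t.+1) (bp t.+1) (bm t.+1) (Kp t) &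
          bm t = b_minus t (ap t.+1) (am t.+1) (bp t.+1) (bm t.+1) (Km t)]]].

(* A Markov policy: pol t x = amounts u_t invested in the risky assets
   when the wealth at time t is x. *)
Definition policy := nat -> R -> 'rV[R]_n.

Fixpoint run (pol : policy) (t m : nat) (X : Omega -> R) : Omega -> R :=
  match m with
  | 0 => X
  | m'.+1 => run pol t.+1 m' (fun w => s t * X w + pK t (pol t (X w)) w)
  end.

Definition XT_from (pol : policy) (t : nat) (x : R) (u : 'rV[R]_n) : Omega -> R :=
  run pol t.+1 (N - t.+1) (fun w => s t * x + pK t u w).

Definition XT (pol : policy) (x0 : R) : Omega -> R := run pol 0 N (cst x0).

(* Var(X_N | X_t = x) - gamma_t(x) E[X_N | X_t = x] *)
Definition nested_obj (pol : policy) (t : nat) (x : R) (u : 'rV[R]_n) : \bar R :=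
  ('V_P[XT_from pol t x u] - (gam t x)%:E * 'E_P[XT_from pol t x u])%E.

Definition time_consistent (pol : policy) : Prop :=
  forall t, (t < N)%N -> forall (x : R) (u : 'rV[R]_n),
    (nested_obj pol t x (pol t x) <= nested_obj pol t x u)%E.

Definition uTC (Kp Km : nat -> 'rV[R]_n) : policy := fun t x =>
  if lvl t <= x then (x - lvl t) *: Kp t else (x - lvl t) *: Km t.

End Market.

(* Main.v *)
(* Let y_t = X_t - W / rho_t. Under the policy u_t = y_t K^{sgn y_t} the deviation is
   multiplied by Z^{sgn y_t} in period t, so that y_N = G_t^{sgn y_t} y_t, where G_t^+ and
   G_t^- depend only on the returns from period t on. With alpha_t = rho_t + a_t and
   q_t = b_t + 2 rho_t a_t + rho_t^2, the recursion says that alpha_t and q_t are the first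
   two moments of G_t; as G_{t+1} is independent of the return of period t, the nested
   objective at u = y K is y^2 F_t(K) up to a constant.

   Minimizers exist because F(K) = H(Z_K) - gamma E[alpha^{sgn Z_K} Z_K] with
     H(Z) = E[(q - alpha^2)^{sgn Z} Z^2] + Var(alpha^{sgn Z} Z),
   and H(P'K) is positively 2-homogeneous, continuous, and positive for K <> 0. The
   positivity rests on the invariant "q >= alpha^2, and alpha > 0 if q = alpha^2": it
   forces Z to be a.s. constant as soon as H(Z) = 0, which positive definiteness of the
   covariance excludes for K <> 0, and it is propagated backward by the same fact. *)
Require Import Defs.
From mathcomp Require Import all_boot all_order all_algebra.
From mathcomp Require Import all_classical all_reals all_analysis measurable_realfun.
From mathcomp Require Import ring lra.

Import Order.TTheory GRing.Theory Num.Theory.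
Import numFieldNormedType.Exports.
Local Open Scope ring_scope.

Set Implicit Arguments.
Unset Strict Implicit.
Unset Printing Implicit Defensive.

(** * Expectation and variance of real random variables *)

Section Expectation.
Context {d : measure_display} {Omega : measurableType d} {R : realType}.
Variable P : probability Omega R.
Implicit Types (X Y : Omega -> R) (k : R).
Local Notation L1 := (Lfun P 1).
Local Notation L2 := (Lfun P 2%:E).

Lemma Lfun_measurable p X : X \in Lfun P p -> measurable_fun setT X.
Proof. by move/sub_Lfun_mfun; rewrite inE. Qed.

Lemma Lfun2P X : X \in L2 <->
  measurable_fun setT X /\ P.-integrable setT (EFin \o (fun w => X w ^+ 2)).
Proof.
split=> [X2|[mX iX2]].
  by split; [exact: Lfun_measurable X2|exact: Lfun2_integrable_sqr].
rewrite inE; apply/andP; split; rewrite inE//= /finite_norm unlock poweR_lty//.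
under eq_integral do rewrite /= powR_mulrn// -normrX.
by move: iX2 => /integrableP[].
Qed.

Lemma Lfun2_sqr X : X \in L2 -> (fun w => X w ^+ 2) \in L1.
Proof. by move=> X2; apply/Lfun1_integrable; exact: Lfun2_integrable_sqr. Qed.

Lemma Lfun2_Lfun1 X : X \in L2 -> X \in L1.
Proof. exact/Lfun_subset12/fin_num_measure. Qed.

Lemma Lfun2D X Y : X \in L2 -> Y \in L2 -> (fun w => X w + Y w) \in L2.
Proof. by move=> X2 Y2; rewrite rpredD ?lee1n. Qed.

Lemma Lfun2B X Y : X \in L2 -> Y \in L2 -> (fun w => X w - Y w) \in L2.
Proof. by move=> X2 Y2; rewrite rpredB ?lee1n. Qed.

Lemma Lfun2_norm X : X \in L2 -> (fun w => `|X w|) \in L2.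
Proof.
move=> X2; apply/Lfun2P; split; first exact: measurableT_comp (Lfun_measurable X2).
rewrite (_ : (fun w => _) = fun w => X w ^+ 2); first exact: Lfun2_integrable_sqr.
by apply/funext => w; rewrite real_normK ?num_real.
Qed.

Lemma Lfun_sum p (I : Type) (r : seq I) (X : I -> Omega -> R) : (1 <= p)%E ->
  (forall i, X i \in Lfun P p) -> (fun w => \sum_(i <- r) X i w) \in Lfun P p.
Proof.
move=> p1 Xp; rewrite (_ : (fun w => _) = \sum_(i <- r) X i); first by rewrite rpred_sum.
by apply/funext => w; rewrite fct_sumE.
Qed.

Lemma le_Lfun1 X Y : measurable_fun setT X -> (forall w, `|X w| <= Y w) ->
  Y \in L1 -> X \in L1.
Proof.
move=> mX XY /Lfun1_integrable iY; apply/Lfun1_integrable.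
apply: le_integrable iY => //; first exact/measurable_EFinP.
by move=> w _ /=; rewrite lee_fin (le_trans (XY w))// ler_norm.
Qed.

Lemma expectation_Ex X : X \in L1 -> 'E_P[X]%E = (Ex P X)%:E.
Proof. by move=> X1; rewrite fineK// expectation_fin_num. Qed.

Lemma Ex_Rintegral X : Ex P X = (\int[P]_w X w)%R.
Proof. by rewrite /Ex unlock. Qed.

Lemma eq_Ex X Y : X =1 Y -> Ex P X = Ex P Y.
Proof. by move=> /funext ->. Qed.

Lemma ae_eq_Ex X Y : measurable_fun setT X -> measurable_fun setT Y ->
  {ae P, forall w, X w = Y w} -> Ex P X = Ex P Y.
Proof.
move=> mX mY XY; rewrite /Ex unlock; congr fine.
apply: ae_eq_integral => //; [exact/measurable_EFinP..|].
by apply: filterS XY => w /= -> _.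
Qed.

Lemma Ex_cst k : Ex P (fun=> k) = k.
Proof. by rewrite /Ex expectation_cst. Qed.

Lemma ExD X Y : X \in L1 -> Y \in L1 -> Ex P (fun w => X w + Y w) = Ex P X + Ex P Y.
Proof.
by move=> /Lfun1_integrable iX /Lfun1_integrable iY; rewrite !Ex_Rintegral RintegralD.
Qed.

Lemma ExB X Y : X \in L1 -> Y \in L1 -> Ex P (fun w => X w - Y w) = Ex P X - Ex P Y.
Proof.
by move=> /Lfun1_integrable iX /Lfun1_integrable iY; rewrite !Ex_Rintegral RintegralB.
Qed.

Lemma ExZ k X : X \in L1 -> Ex P (fun w => k * X w) = k * Ex P X.
Proof. by move=> /Lfun1_integrable iX; rewrite !Ex_Rintegral RintegralZl. Qed.

Lemma Ex_sum (I : Type) (r : seq I) (X : I -> Omega -> R) :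
  (forall i, X i \in L1) ->
  Ex P (fun w => \sum_(i <- r) X i w) = \sum_(i <- r) Ex P (X i).
Proof.
move=> X1; elim: r => [|i r IH].
  by rewrite big_nil -[RHS]Ex_cst; apply: eq_Ex => w; rewrite big_nil.
rewrite big_cons -IH -ExD//; last exact: Lfun_sum.
by apply: eq_Ex => w; rewrite big_cons.
Qed.

Lemma Ex_ge0 X : (forall w, 0 <= X w) -> 0 <= Ex P X.
Proof. by move=> X0; rewrite Ex_Rintegral Rintegral_ge0. Qed.

Lemma le_Ex X Y : X \in L1 -> Y \in L1 -> (forall w, X w <= Y w) -> Ex P X <= Ex P Y.
Proof.
by move=> /Lfun1_integrable iX /Lfun1_integrable iY XY; rewrite !Ex_Rintegral le_Rintegral.
Qed.

Lemma le_norm_Ex X Y : X \in L1 -> Y \in L1 -> (forall w, `|X w| <= Y w) ->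
  `|Ex P X| <= Ex P Y.
Proof.
move=> X1 Y1 XY; apply: le_trans (le_Ex (Lfun_norm X1) Y1 XY).
by rewrite !Ex_Rintegral le_normr_Rintegral//; exact/Lfun1_integrable.
Qed.

Lemma Ex_eq0_ae X : X \in L1 -> (forall w, 0 <= X w) -> Ex P X = 0 ->
  {ae P, forall w, X w = 0}.
Proof.
move=> X1 X0 EX0; have /Lfun1_integrable/measurable_int mX := X1.
have : (\int[P]_w `|(EFin \o X) w| = 0)%E.
  transitivity ('E_P[X])%E; last by rewrite expectation_Ex// EX0.
  by rewrite unlock; apply: eq_integral => w _ /=; rewrite ger0_norm.
move/(ae_eq_integral_abs P measurableT mX).
by apply: filterS => w /= /(_ I) [].
Qed.

Section SplitAtZero.
Variables (Z : Omega -> R) (f : bool -> Omega -> R).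
Hypotheses (mZ : measurable_fun setT Z) (f1 : forall b, f b \in L1).

Let restrict_Lfun1 (D : pred R) b : measurable_fun setT (D \o Z) ->
  (fun w => if D (Z w) then f b w else 0) \in L1.
Proof.
move=> mD; apply: le_Lfun1 (Lfun_norm (f1 b)) => [|w /=]; last by case: ifP; rewrite ?normr0.
by apply: measurable_fun_ifT => //; exact: Lfun_measurable (f1 b).
Qed.

Lemma Ex_split_ge : Ex P (fun w => f (0 <= Z w) w) =
  Ex P (fun w => if 0 <= Z w then f true w else 0) +
  Ex P (fun w => if Z w < 0 then f false w else 0).
Proof.
rewrite -ExD; [by apply: eq_Ex => w; case: leP; rewrite ?addr0 ?add0r| |].
- by apply: (restrict_Lfun1 (D := fun z => 0 <= z)); exact: measurable_fun_ler.
- by apply: (restrict_Lfun1 (D := fun z => z < 0)); exact: measurable_fun_ltr.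
Qed.

Lemma Ex_split_le : Ex P (fun w => f (Z w <= 0) w) =
  Ex P (fun w => if Z w <= 0 then f true w else 0) +
  Ex P (fun w => if 0 < Z w then f false w else 0).
Proof.
rewrite -ExD; [by apply: eq_Ex => w; case: leP; rewrite ?addr0 ?add0r| |].
- by apply: (restrict_Lfun1 (D := fun z => z <= 0)); exact: measurable_fun_ler.
- by apply: (restrict_Lfun1 (D := fun z => 0 < z)); exact: measurable_fun_ltr.
Qed.

End SplitAtZero.

Definition Var X : R := fine ('V_P[X])%E.

Lemma variance_Var X : X \in L2 -> 'V_P[X]%E = (Var X)%:E.
Proof. by move=> X2; rewrite fineK// variance_fin_num. Qed.

Lemma Var_deviation X : Var X = Ex P (fun w => (X w - Ex P X) ^+ 2).
Proof. by rewrite /Var /variance unlock. Qed.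

Lemma VarE X : X \in L2 -> Var X = Ex P (fun w => X w ^+ 2) - Ex P X ^+ 2.
Proof.
move=> X2; rewrite /Var varianceE// (expectation_Ex (Lfun2_Lfun1 X2)).
have -> : 'E_P[X ^+ 2]%E = (Ex P (fun w => X w ^+ 2))%:E.
  exact: expectation_Ex (Lfun2_sqr X2).
by [].
Qed.

Lemma Var_ge0 X : 0 <= Var X.
Proof. by rewrite Var_deviation; apply: Ex_ge0 => w; exact: sqr_ge0. Qed.

Lemma Var_eq0_ae X : X \in L2 -> Var X = 0 -> {ae P, forall w, X w = Ex P X}.
Proof.
move=> X2; rewrite Var_deviation => V0.
have dev2 : (fun w => X w - Ex P X) \in L2 by exact: Lfun2B X2 (Lfun_cst _ _ _).
apply: filterS (Ex_eq0_ae (Lfun2_sqr dev2) (fun w => sqr_ge0 _) V0) => w /eqP.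
by rewrite sqrf_eq0 subr_eq0 => /eqP.
Qed.

Lemma Var_ae_cst X k : measurable_fun setT X -> {ae P, forall w, X w = k} -> Var X = 0.
Proof.
move=> mX Xk; have EX : Ex P X = k by rewrite (ae_eq_Ex mX _ Xk) ?Ex_cst.
rewrite Var_deviation EX -[RHS]Ex_cst; apply: ae_eq_Ex => //.
  exact/measurable_funX/measurable_funB.
by apply: filterS Xk => w ->; rewrite subrr expr0n.
Qed.

End Expectation.
Arguments eq_Ex {d Omega R P X} Y.

(** * Independence *)

Section IndependentVariables.
Context {d : measure_display} {Omega : measurableType d} {R : realType}.
Variable P : probability Omega R.
Implicit Types (X Y : Omega -> R).
Local Open Scope classical_set_scope.
Local Notation L1 := (Lfun P 1).

Definition independent X Y := forall A B, measurable A -> measurable B ->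
  P (X @^-1` A `&` Y @^-1` B) = (P (X @^-1` A) * P (Y @^-1` B))%E.

Lemma independent_comp (f g : R -> R) X Y :
  measurable_fun setT f -> measurable_fun setT g ->
  independent X Y -> independent (f \o X) (g \o Y).
Proof.
move=> mf mg XY A B mA mB; apply: (XY (f @^-1` A) (g @^-1` B));
  rewrite -[X in measurable X]setTI; [exact: mf|exact: mg].
Qed.

Lemma independent_cst k Y : independent (fun=> k) Y.
Proof.
move=> A B _ _; rewrite !preimage_cst; case: ifP => _.
  by rewrite setTI probability_setT mul1e.
by rewrite set0I measure0 mul0e.
Qed.

Section ProductExpectation.
Variables X Y : Omega -> R.
Hypotheses (X1 : X \in L1) (Y1 : Y \in L1) (XY : independent X Y).

Let rX : {mfun Omega >-> R} := mfun_Sub (sub_Lfun_mfun X1).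
Let rY : {mfun Omega >-> R} := mfun_Sub (sub_Lfun_mfun Y1).
Let joint : {mfun Omega >-> (R * R)%type} := mfun_Sub (mem_set
  (measurable_fun_pair (Lfun_measurable X1) (Lfun_measurable Y1))).
Local Notation PX := (distribution P rX).
Local Notation PY := (distribution P rY).
Local Notation pair_mul := (fun z : R * R => (z.1 * z.2)%:E).

Let measurable_pair_mul : measurable_fun setT pair_mul.
Proof. exact/measurable_EFinP/measurable_funM. Qed.

Let distribution_joint A : measurable A -> (PX \x PY)%E A = distribution P joint A.
Proof. by apply: product_measure_unique => B C mB mC; exact: XY. Qed.

Let integrable_distribution (Z : {mfun Omega >-> R}) : (Z : Omega -> R) \in L1 ->
  (distribution P Z).-integrable setT EFin.
Proof.
by move=> /Lfun1_integrable iZ; apply: integrable_pushforward => //; exact/measurable_EFinP.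
Qed.

Let integrable_pair_mul : ((PX \x PY).-integrable setT pair_mul)%E.
Proof.
have fin_norm (Z : {mfun Omega >-> R}) : (Z : Omega -> R) \in L1 ->
    (\int[distribution P Z]_x `|x|%:E)%E \is a fin_num.
  by move=> /integrable_distribution/integrable_abse/integrable_fin_num; apply.
apply/integrable12ltyP => //=.
under eq_integral => x _ do (under eq_integral => y _ do rewrite /= normrM EFinM;
  rewrite ge0_integralZl//; last exact/measurableT_comp).
rewrite /= ge0_integralZr//; [|exact/measurableT_comp|exact: integral_ge0].
by rewrite ltey_eq fin_numM ?fin_norm.
Qed.

Lemma independentM_Lfun1 : (fun w => X w * Y w) \in L1.
Proof.
have /integrableP[_ XYoo] := integrable_pair_mul.
apply/Lfun1_integrable/integrableP; split.
  by apply/measurable_EFinP/measurable_funM; [exact: Lfun_measurable X1|exact: Lfun_measurable Y1].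
have := ge0_integral_distribution (P := P) joint (f := abse \o pair_mul).
rewrite -(eq_measure_integral _ (fun A mA _ => distribution_joint mA)).
move=> /(_ _ _)/= <- //; exact: measurableT_comp.
Qed.

(* Fubini, as the joint law of independent variables is the product of their laws. *)
Lemma independent_ExM : Ex P (fun w => X w * Y w) = Ex P X * Ex P Y.
Proof.
have mean (Z : {mfun Omega >-> R}) : (Z : Omega -> R) \in L1 ->
    (\int[distribution P Z]_x x%:E = 'E_P[Z])%E.
  by move=> /Lfun1_integrable iZ; rewrite unlock integral_distribution//; exact/measurable_EFinP.
apply: EFin_inj; rewrite EFinM -!expectation_Ex//; last exact: independentM_Lfun1.
transitivity (\int[distribution P joint]_z pair_mul z)%E.
  rewrite unlock integral_distribution//; exact/Lfun1_integrable/independentM_Lfun1.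
rewrite -(eq_measure_integral _ (fun A mA _ => distribution_joint mA)).
rewrite -(integral12_prod_meas1 integrable_pair_mul) /fubini_F/=.
have [iX iY] := (integrable_distribution (Z := rX) X1, integrable_distribution (Z := rY) Y1).
under eq_integral => x _.
  under eq_integral do rewrite EFinM.
  rewrite (integralZl _ iY)//= (mean rY Y1) (expectation_Ex Y1).
  over.
by rewrite (integralZr _ iX)// (mean rX X1) (expectation_Ex Y1).
Qed.

End ProductExpectation.
End IndependentVariables.

Section IndependentReturns.
Context {d : measure_display} {Omega : measurableType d} {R : realType}.
Variables (P : probability Omega R) (n : nat) (Pc : nat -> 'I_n -> Omega -> R) (N : nat).
Hypothesis mPc : forall t i, (t < N)%N -> measurable_fun setT (Pc t i).
Hypothesis indep : indep_returns P Pc N.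
Local Open Scope classical_set_scope.

Lemma product_rule_g_sigma_algebra (G : set (set Omega)) A :
  measurable A -> G `<=` measurable -> G setT -> setI_closed G ->
  (forall B, G B -> P (A `&` B) = P A * P B)%E ->
  forall B, <<s G >> B -> (P (A `&` B) = P A * P B)%E.
Proof.
move=> mA mG GT GI PAB B sB.
have PA : (P A = (fine (P A))%:E)%E by rewrite fineK// fin_num_measure.
pose PA_nng := NngNum (fine_ge0 (measure_ge0 P A)).
rewrite setIC PA.
apply: (g_sigma_algebra_measure_unique G mG (fun=> setT) (fun=> GT) _
  (mrestr P mA) (mscale PA_nng P) GI _ _ _ sB) => [|C GC|k].
- by rewrite bigcup_const.
- by rewrite /= /mrestr /mscale/= setIC PAB// PA.
- by rewrite /mrestr/= ltey_eq fin_num_measure//; exact: measurableI.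
Qed.

Lemma g_sigma_algebra_preimage (G : set (set Omega)) (X : g_sigma_algebraType G -> R)
  (B : set R) : measurable_fun setT X -> measurable B -> <<s G >> (X @^-1` B).
Proof. by move=> mX mB; rewrite -[_ @^-1` _]setTI; exact: mX. Qed.

Lemma g_sigma_algebra_measurable_funS (G H : set (set Omega)) (X : Omega -> R) :
  G `<=` <<s H >> -> measurable_fun setT (X : g_sigma_algebraType G -> R) ->
  measurable_fun setT (X : g_sigma_algebraType H -> R).
Proof.
move=> GH mX _ B mB; apply: (smallest_sub (smallest_sigma_algebra setT H) GH).
exact: mX.
Qed.

(* [sigmaP Pc t] unfolds to [<<s return_events t>>]. *)
Definition return_events t : set (set Omega) :=
  [set A | exists i (B : set R), measurable B /\ A = Pc t i @^-1` B].

Definition future_events t : set (set Omega) :=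
  [set B | exists2 A : nat -> set Omega, forall j, (t <= j < N)%N -> sigmaP Pc j (A j) &
    B = \bigcap_(j in [set j | (t <= j < N)%N]) A j].

Lemma measurable_pK t K :
  measurable_fun setT (pK Pc t K : g_sigma_algebraType (return_events t) -> R).
Proof.
apply: measurable_sum => i; apply: measurable_funM => //.
by move=> _ B mB; rewrite setTI; apply: sub_sigma_algebra; exists i, B.
Qed.

Lemma sigmaPT t : sigmaP Pc t setT.
Proof. exact: (@measurableT _ (g_sigma_algebraType (return_events t))). Qed.

Lemma sigmaP_measurable t A : (t < N)%N -> sigmaP Pc t A -> measurable A.
Proof.
move=> tN; apply: smallest_sub; first exact: sigma_algebra_measurable.
by move=> _ [i [B [mB ->]]]; rewrite -[X in measurable X]setTI; exact: mPc.
Qed.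

Lemma future_events_measurable t : future_events t `<=` measurable.
Proof.
move=> _ [A sA ->]; apply: bigcap_measurableType => j tjN.
by apply: sigmaP_measurable (sA j tjN); case/andP: tjN.
Qed.

Lemma future_eventsT t : future_events t setT.
Proof. by exists (fun=> setT) => [j _|]; [exact: sigmaPT|rewrite bigcapT]. Qed.

Lemma future_eventsI t : setI_closed (future_events t).
Proof.
move=> _ _ [A sA ->] [B sB ->]; exists (fun j => A j `&` B j); last by rewrite bigcapI.
move=> j tjN; apply: (@measurableI _ (g_sigma_algebraType (return_events j))).
  exact: sA.
exact: sB.
Qed.

Lemma future_events_le t u : (t <= u)%N -> future_events u `<=` future_events t.
Proof.
move=> tu _ [A sA ->]; exists (fun j => if (u <= j)%N then A j else setT).
  move=> j /andP[_ jN]; case: ifP => uj; last exact: sigmaPT.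
  by apply: sA; rewrite uj.
apply/seteqP; split => w /= wA j.
  by move=> /= /andP[_ jN]; case: ifP => // uj; apply: wA; rewrite /= uj.
move=> /= /andP[uj jN]; have := wA j; rewrite /= uj; apply.
by rewrite jN (leq_trans tu uj).
Qed.

Lemma return_events_future t : (t < N)%N -> return_events t `<=` future_events t.
Proof.
move=> tN B tB; exists (fun j => if j == t then B else setT) => [j _|].
  by case: eqP => [->|_]; [exact: sub_sigma_algebra|exact: sigmaPT].
apply/seteqP; split => w; first by move=> wB j _; case: ifP.
by move=> /(_ t); rewrite /= eqxx leqnn; exact.
Qed.

Lemma prob_future_events t A : (forall j, (t <= j < N)%N -> sigmaP Pc j (A j)) ->
  P (\bigcap_(j in [set j | (t <= j < N)%N]) A j) = (\prod_(j < N | (t <= j)%N) P (A j))%E.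
Proof.
move=> sA; pose A' j := if (t <= j)%N then A j else setT.
have -> : \bigcap_(j in [set j | (t <= j < N)%N]) A j = \bigcap_(j in [set j | (j < N)%N]) A' j.
  apply/seteqP; split => w wA j /=.
    by rewrite /A' => jN; case: ifP => // tj; apply: wA; rewrite /= tj.
  by move=> /andP[tj jN]; have := wA j jN; rewrite /A' tj.
rewrite (indep (A := A')).
  rewrite [RHS]big_mkcond; apply: eq_bigr => j _; rewrite /A'; case: ifP => // _.
  exact: probability_setT.
by move=> j jN; rewrite /A'; case: ifP => tj; [apply: sA; rewrite tj|exact: sigmaPT].
Qed.

Lemma indep_future_events t A B : (t < N)%N -> sigmaP Pc t A -> future_events t.+1 B ->
  (P (A `&` B) = P A * P B)%E.
Proof.
move=> tN tA [C sC ->].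
pose C' j := if j == t then A else C j.
have -> : A `&` \bigcap_(j in [set j | (t < j < N)%N]) C j =
    \bigcap_(j in [set j | (t <= j < N)%N]) C' j.
  apply/seteqP; split => w.
    move=> [wA wC] j /= /andP[]; rewrite leq_eqVlt /C' eq_sym.
    by case: eqP => //= _ tj jN; apply: wC; rewrite /= tj.
  move=> wC; split; first by have := wC t; rewrite /C'/= eqxx leqnn; exact.
  move=> j /= /andP[tj jN]; have := wC j; rewrite /C'/= (gtn_eqF tj) ltnW//; exact.
rewrite !prob_future_events//; last first.
  move=> j /andP[tj jN]; rewrite /C'; case: eqP => [->//|/eqP jt].
  by apply: sC; rewrite ltn_neqAle eq_sym jt tj.
rewrite (bigD1 (Ordinal tN))//= /C' eqxx; congr (_ * _)%E.
apply: eq_big => j /=; first by rewrite ltn_neqAle andbC eq_sym.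
by rewrite -val_eqE /= => /andP[_ /negPf->].
Qed.

Lemma independent_future t (X : g_sigma_algebraType (return_events t) -> R)
    (Y : g_sigma_algebraType (future_events t.+1) -> R) : (t < N)%N ->
  measurable_fun setT X -> measurable_fun setT Y -> independent P X Y.
Proof.
move=> tN mX mY A B mA mB.
have sA : sigmaP Pc t (X @^-1` A) by exact: g_sigma_algebra_preimage.
apply: (@product_rule_g_sigma_algebra (future_events t.+1)).
- exact: sigmaP_measurable sA.
- exact: future_events_measurable.
- exact: future_eventsT.
- exact: future_eventsI.
- by move=> C; exact: indep_future_events.
- exact: g_sigma_algebra_preimage.
Qed.

End IndependentReturns.

(** * Functions that are linear or quadratic on each side of the origin *)

Section SidedFunctions.
Context {R : realType}.
Implicit Types (p q : bool -> R) (x y z k : R).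

Definition sided_lin p z := p (0 <= z) * z.
Definition sided_sqr q z := q (0 <= z) * z ^+ 2.

Lemma sided_sqrE q z : sided_sqr q z = sided_lin q z * z.
Proof. by rewrite /sided_lin -mulrA. Qed.

Definition mirror {T : Type} (p : bool -> T) (b : bool) : bool -> T := fun c => p (b == c).

Lemma sided_linM p k z : sided_lin p (k * z) = k * sided_lin (mirror p (0 <= k)) z.
Proof.
rewrite /sided_lin /mirror mulrCA; have [->|k0] := eqVneq k 0; first by rewrite !mul0r.
have [->|z0] := eqVneq z 0; first by rewrite !mulr0.
congr (_ * (p _ * _)); case: (ltgtP 0 k) k0 => // k0 _.
  by rewrite pmulr_rge0.
by rewrite nmulr_rge0// leNgt lt_neqAle eq_sym z0/=; case: leP.
Qed.

Lemma sided_sqrM q k z : sided_sqr q (k * z) = k ^+ 2 * sided_sqr (mirror q (0 <= k)) z.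
Proof. by rewrite !sided_sqrE sided_linM; ring. Qed.

Lemma sided_lin_normE p z :
  sided_lin p z = (p true + p false) / 2 * z + (p true - p false) / 2 * `|z|.
Proof. by rewrite /sided_lin; case: leP => z0; [rewrite ger0_norm|rewrite ltr0_norm]; lra. Qed.

Lemma sided_sqr_normE q z :
  sided_sqr q z = (q true + q false) / 2 * z ^+ 2 + (q true - q false) / 2 * (z * `|z|).
Proof. by rewrite sided_sqrE sided_lin_normE; ring. Qed.

Definition slope_bound p := `|p true| + `|p false|.

Lemma slope_bound_ge0 p : 0 <= slope_bound p.
Proof. exact: addr_ge0. Qed.

Let half_combination_le p u v e : `|u| <= e -> `|v| <= e ->
  `|(p true + p false) / 2 * u + (p true - p false) / 2 * v| <= slope_bound p * e.
Proof.
move=> ue ve.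
rewrite (_ : _ + _ = p true * ((u + v) / 2) + p false * ((u - v) / 2)); last by field.
rewrite (le_trans (ler_normD _ _))// /slope_bound [leRHS]mulrDl lerD// normrM ler_wpM2l//;
  move: ue ve; rewrite !ler_norml => /andP[? ?] /andP[? ?]; apply/andP; split; lra.
Qed.

Lemma norm_sided_lin p z : `|sided_lin p z| <= slope_bound p * `|z|.
Proof. by rewrite sided_lin_normE half_combination_le ?normr_id. Qed.

Lemma sided_lin_dist p x y : `|sided_lin p x - sided_lin p y| <= slope_bound p * `|x - y|.
Proof.
rewrite !sided_lin_normE [X in `|X|](_ : _ = (p true + p false) / 2 * (x - y) +
  (p true - p false) / 2 * (`|x| - `|y|)); last by ring.
by rewrite half_combination_le// ler_dist_dist.
Qed.

Lemma sided_sqr_dist q x y :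
  `|sided_sqr q x - sided_sqr q y| <= slope_bound q * (`|x - y| * (`|x| + `|y|)).
Proof.
rewrite !sided_sqr_normE [X in `|X|](_ : _ = (q true + q false) / 2 * (x ^+ 2 - y ^+ 2) +
  (q true - q false) / 2 * (x * `|x| - y * `|y|)); last by ring.
apply: half_combination_le; first by rewrite subr_sqr normrM ler_wpM2l// ler_normD.
rewrite (_ : x * _ - _ = (x - y) * `|x| + y * (`|x| - `|y|)); last by ring.
rewrite (le_trans (ler_normD _ _))// !normrM normr_id mulrDr lerD//.
by rewrite mulrC ler_wpM2r// ler_dist_dist.
Qed.

(* The invariant of the backward recursion; its second clause excludes the two-point laws
   of a variable [Z] on which [sided_lin p Z] is constant. *)
Definition nondegenerate (a q : R) := a ^+ 2 <= q /\ (q = a ^+ 2 -> 0 < a).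

Lemma nondegenerate_sided_inj p q y z : (forall b, nondegenerate (p b) (q b)) ->
  sided_sqr (fun b => q b - p b ^+ 2) y = 0 -> sided_sqr (fun b => q b - p b ^+ 2) z = 0 ->
  sided_lin p y = sided_lin p z -> y = z.
Proof.
move=> pq; have slope_gt0 x :
    sided_sqr (fun b => q b - p b ^+ 2) x = 0 -> x != 0 -> 0 < p (0 <= x).
  move=> /eqP + x0; rewrite mulf_eq0 sqrf_eq0 (negPf x0) orbF subr_eq0 => /eqP.
  by case: (pq (0 <= x)) => _; exact.
move=> /slope_gt0 py /slope_gt0 pz.
have [y0|/py{}py] := eqVneq y 0; have [z0|/pz{}pz] := eqVneq z 0; first by rewrite y0 z0.
- by rewrite /sided_lin y0 mulr0 => /esym/eqP; rewrite mulf_eq0 gt_eqF//= => /eqP->.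
- by rewrite /sided_lin z0 mulr0 => /eqP; rewrite mulf_eq0 gt_eqF//= => /eqP->.
move=> pyz; have side : (0 <= y) = (0 <= z).
  by rewrite -(pmulr_rge0 y py) -(pmulr_rge0 z pz); congr (0 <= _).
by move: pyz; rewrite /sided_lin side; apply/mulfI; rewrite gt_eqF.
Qed.

Lemma measurable_sided (p : bool -> R) : measurable_fun setT (fun z => p (0 <= z)).
Proof.
rewrite (_ : (fun z => _) = fun z => if 0 <= z then p true else p false).
  by apply: measurable_fun_ifT => //; exact: measurable_fun_ler.
by apply/funext => z; case: ifP.
Qed.

Lemma measurable_sided_lin p : measurable_fun setT (sided_lin p).
Proof. by apply: measurable_funM => //; exact: measurable_sided. Qed.

End SidedFunctions.

Section SidedMoments.
Context {d : measure_display} {Omega : measurableType d} {R : realType}.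
Variable P : probability Omega R.
Implicit Types (X Y Z : Omega -> R) (p q : bool -> R) (k : R).
Local Notation L1 := (Lfun P 1).
Local Notation L2 := (Lfun P 2%:E).

Definition sided_mean p Z := Ex P (fun w => sided_lin p (Z w)).
Definition sided_sqmean q Z := Ex P (fun w => sided_sqr q (Z w)).
Definition sided_var p q Z := sided_sqmean q Z - sided_mean p Z ^+ 2.

Lemma Lfun1_sided_lin p Z : Z \in L1 -> (fun w => sided_lin p (Z w)) \in L1.
Proof.
move=> Z1; apply: (@le_Lfun1 _ _ _ _ _ (fun w => slope_bound p * `|Z w|)).
- exact: measurableT_comp (measurable_sided_lin p) (Lfun_measurable Z1).
- by move=> w; exact: norm_sided_lin.
- by apply: rpredZ; exact: Lfun_norm.
Qed.

Lemma Lfun1_sided_sqr q Z : Z \in L2 -> (fun w => sided_sqr q (Z w)) \in L1.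
Proof.
move=> Z2; have Zsqr := Lfun2_sqr Z2; have mZ := Lfun_measurable Z2.
apply: (@le_Lfun1 _ _ _ _ _ (fun w => slope_bound q * Z w ^+ 2)); last exact: rpredZ.
  apply: measurable_funM; last exact: Lfun_measurable Zsqr.
  exact: measurableT_comp (measurable_sided q) mZ.
move=> w; have := sided_sqr_dist q (Z w) 0.
by rewrite /sided_sqr expr0n/= mulr0 !subr0 normr0 addr0 -normrM -expr2 ger0_norm ?sqr_ge0.
Qed.

Lemma Lfun2_sided_lin p Z : Z \in L2 -> (fun w => sided_lin p (Z w)) \in L2.
Proof.
move=> Z2; apply/Lfun2P; split.
  exact: measurableT_comp (measurable_sided_lin p) (Lfun_measurable Z2).
apply/Lfun1_integrable; rewrite (_ : (fun w => _) = fun w => sided_sqr (fun b => p b ^+ 2) (Z w)).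
  exact: Lfun1_sided_sqr.
by apply/funext => w; rewrite exprMn.
Qed.

Lemma sided_mean_cst p k : sided_mean p (fun=> k) = sided_lin p k.
Proof. exact: Ex_cst. Qed.

Lemma sided_sqmean_cst q k : sided_sqmean q (fun=> k) = sided_sqr q k.
Proof. exact: Ex_cst. Qed.

Lemma sided_mean_linear k p p' Z : Z \in L1 ->
  sided_mean (fun b => k * p b + p' b) Z = k * sided_mean p Z + sided_mean p' Z.
Proof.
move=> Z1; have i := Lfun1_sided_lin _ Z1.
rewrite /sided_mean -ExZ// -ExD//; last exact: rpredZ.
by apply: eq_Ex => w; rewrite /sided_lin mulrDl mulrA.
Qed.

Lemma sided_sqmean_linear k q q' Z : Z \in L2 ->
  sided_sqmean (fun b => k * q b + q' b) Z = k * sided_sqmean q Z + sided_sqmean q' Z.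
Proof.
move=> Z2; have i := Lfun1_sided_sqr _ Z2.
rewrite /sided_sqmean -ExZ// -ExD//; last exact: rpredZ.
by apply: eq_Ex => w; rewrite /sided_sqr mulrDl mulrA.
Qed.

Lemma sided_mean_cst_slope k Z : Z \in L1 -> sided_mean (fun=> k) Z = k * Ex P Z.
Proof. exact: ExZ. Qed.

Lemma sided_sqmean_cst_slope k Z : Z \in L2 ->
  sided_sqmean (fun=> k) Z = k * Ex P (fun w => Z w ^+ 2).
Proof. by move=> /Lfun2_sqr; exact: ExZ. Qed.

Lemma sided_meanM p k Z : Z \in L1 ->
  sided_mean p (fun w => k * Z w) = k * sided_mean (mirror p (0 <= k)) Z.
Proof.
move=> Z1; rewrite -ExZ; last exact: Lfun1_sided_lin.
by apply: eq_Ex => w; exact: sided_linM.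
Qed.

Lemma sided_sqmeanM q k Z : Z \in L2 ->
  sided_sqmean q (fun w => k * Z w) = k ^+ 2 * sided_sqmean (mirror q (0 <= k)) Z.
Proof.
move=> Z2; rewrite -ExZ; last exact: Lfun1_sided_sqr.
by apply: eq_Ex => w; exact: sided_sqrM.
Qed.

Lemma sided_varM p q k Z : Z \in L2 ->
  sided_var p q (fun w => k * Z w) = k ^+ 2 * sided_var (mirror p (0 <= k)) (mirror q (0 <= k)) Z.
Proof.
move=> Z2; rewrite /sided_var sided_sqmeanM// sided_meanM; first by ring.
exact: Lfun2_Lfun1.
Qed.

Lemma sided_sqmean_ge0 q Z : (forall b, 0 <= q b) -> 0 <= sided_sqmean q Z.
Proof. by move=> q0; apply: Ex_ge0 => w; rewrite mulr_ge0 ?sqr_ge0. Qed.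

Lemma sided_var_split p q Z : Z \in L2 ->
  sided_var p q Z =
  sided_sqmean (fun b => q b - p b ^+ 2) Z + Var P (fun w => sided_lin p (Z w)).
Proof.
move=> Z2; rewrite VarE; last exact: Lfun2_sided_lin.
rewrite addrA; congr (_ - _); rewrite -ExD.
- by apply: eq_Ex => w; rewrite /sided_sqr /sided_lin; ring.
- exact: Lfun1_sided_sqr.
- exact/Lfun2_sqr/Lfun2_sided_lin.
Qed.

Section Nondegenerate.
Variables (p q : bool -> R) (Z : Omega -> R).
Hypotheses (pq : forall b, nondegenerate (p b) (q b)) (Z2 : Z \in L2).

Let residual_ge0 b : 0 <= q b - p b ^+ 2.
Proof. by rewrite subr_ge0; case: (pq b). Qed.

Lemma sided_var_ge0 : 0 <= sided_var p q Z.
Proof. by rewrite sided_var_split// addr_ge0 ?Var_ge0// sided_sqmean_ge0. Qed.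

Lemma sided_var_eq0_ae_cst : sided_var p q Z = 0 -> exists k, {ae P, forall w, Z w = k}.
Proof.
rewrite sided_var_split// => /eqP; rewrite paddr_eq0 ?Var_ge0 ?sided_sqmean_ge0//.
move=> /andP[/eqP res0 /eqP /(Var_eq0_ae (Lfun2_sided_lin p Z2)) lin_cst].
have {}res0 : {ae P, forall w, sided_sqr (fun b => q b - p b ^+ 2) (Z w) = 0}.
  by apply: Ex_eq0_ae => [|w|//]; [exact: Lfun1_sided_sqr|rewrite mulr_ge0 ?sqr_ge0].
have [[k [resk link]]|none] := pselect (exists z,
    sided_sqr (fun b => q b - p b ^+ 2) z = 0 /\ sided_lin p z = sided_mean p Z).
  exists k; apply: filterS2 res0 lin_cst => w resw linw.
  by apply: nondegenerate_sided_inj pq resw resk _; rewrite linw link.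
by exists 0; apply: filterS2 res0 lin_cst => w resw linw; case: none; exists (Z w).
Qed.

End Nondegenerate.

Section Distance.
Variables (p q : bool -> R) (Y Z : Omega -> R).
Hypotheses (Y2 : Y \in L2) (Z2 : Z \in L2).

Let dist2 : (fun w => `|Y w - Z w|) \in L2.
Proof. exact/Lfun2_norm/Lfun2B. Qed.

Lemma norm_sided_mean : `|sided_mean p Z| <= slope_bound p * Ex P (fun w => `|Z w|).
Proof.
have Z1 := Lfun2_Lfun1 Z2; rewrite -ExZ; last exact: Lfun_norm.
apply: le_norm_Ex => [||w]; [exact: Lfun1_sided_lin|by apply: rpredZ; exact: Lfun_norm|].
exact: norm_sided_lin.
Qed.

Lemma sided_mean_dist :
  `|sided_mean p Y - sided_mean p Z| <= slope_bound p * Ex P (fun w => `|Y w - Z w|).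
Proof.
have [lY lZ] := (Lfun2_sided_lin p Y2, Lfun2_sided_lin p Z2).
rewrite -ExB; [|exact: Lfun2_Lfun1..]; rewrite -ExZ; last exact: Lfun2_Lfun1.
apply: le_norm_Ex => [||w]; last exact: sided_lin_dist.
- by apply: rpredB; exact: Lfun2_Lfun1.
- by apply: rpredZ; exact: Lfun2_Lfun1.
Qed.

Lemma sided_sqmean_dist :
  `|sided_sqmean q Y - sided_sqmean q Z| <=
  slope_bound q * Ex P (fun w => `|Y w - Z w| * (`|Y w| + `|Z w|)).
Proof.
have [sY sZ] := (Lfun1_sided_sqr q Y2, Lfun1_sided_sqr q Z2).
have product_Lfun1 : (fun w => `|Y w - Z w| * (`|Y w| + `|Z w|)) \in L1.
  by apply: Lfun2_mul_Lfun1 => //; apply: Lfun2D; exact: Lfun2_norm.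
rewrite -ExB// -ExZ//; apply: le_norm_Ex => [||w]; last exact: sided_sqr_dist.
- exact: rpredB.
- exact: rpredZ.
Qed.

End Distance.

Lemma sided_var_dist p q Y Z : Y \in L2 -> Z \in L2 ->
  `|sided_var p q Y - sided_var p q Z| <=
  slope_bound q * Ex P (fun w => `|Y w - Z w| * (`|Y w| + `|Z w|)) +
  slope_bound p ^+ 2 *
    (Ex P (fun w => `|Y w - Z w|) * (Ex P (fun w => `|Y w|) + Ex P (fun w => `|Z w|))).
Proof.
move=> Y2 Z2; rewrite [X in `|X|](_ : _ = (sided_sqmean q Y - sided_sqmean q Z) -
  (sided_mean p Y - sided_mean p Z) * (sided_mean p Y + sided_mean p Z)); last first.
  by rewrite /sided_var; ring.
rewrite (le_trans (ler_normB _ _))// lerD ?sided_sqmean_dist// normrM expr2 mulrACA.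
by rewrite ler_pM ?sided_mean_dist// mulrDr (le_trans (ler_normD _ _))// lerD ?norm_sided_mean.
Qed.

Lemma independent_sided_ExM (G : bool -> Omega -> R) Y (h : R -> R) :
  (forall b, independent P Y (G b)) -> (forall b, G b \in L1) -> measurable_fun setT Y ->
  measurable_fun setT h -> (fun w => h (Y w)) \in L1 ->
  (fun w => G (0 <= Y w) w * h (Y w)) \in L1 /\
  Ex P (fun w => G (0 <= Y w) w * h (Y w)) = Ex P (fun w => Ex P (G (0 <= Y w)) * h (Y w)).
Proof.
move=> YG G1 mY mh hY1; pose f b y := (b == (0 <= y))%:R * h y.
have mf b : measurable_fun setT (f b).
  by apply: measurable_funM => //; exact: (measurable_sided (fun c => (b == c)%:R)).
have fY1 b : (fun w => f b (Y w)) \in L1.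
  apply: le_Lfun1 (Lfun_norm hY1) => [|w]; first exact: measurableT_comp.
  by rewrite /f normrM ler_piMl//; case: eqP; rewrite ?normr1 ?normr0.
have fYG b : independent P (fun w => f b (Y w)) (G b).
  exact: (independent_comp (mf b) (@measurable_id _ _ setT) (YG b)).
have product_Lfun1 b := independentM_Lfun1 (fY1 b) (G1 b) (fYG b).
have splitE (g : bool -> Omega -> R) : (fun w => g (0 <= Y w) w * h (Y w)) =
    fun w => f true (Y w) * g true w + f false (Y w) * g false w.
  by apply/funext => w; rewrite /f; case: (0 <= Y w) => /=; ring.
rewrite splitE (splitE (fun b _ => Ex P (G b))); split; first exact: rpredD.
rewrite !ExD//; last 2 first.
- by rewrite (_ : (fun w => _) = fun w => Ex P (G true) * f true (Y w)) ?rpredZ//;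
    apply/funext => w; rewrite mulrC.
- by rewrite (_ : (fun w => _) = fun w => Ex P (G false) * f false (Y w)) ?rpredZ//;
    apply/funext => w; rewrite mulrC.
congr (_ + _); rewrite independent_ExM// mulrC -ExZ//; apply: eq_Ex => w; exact: mulrC.
Qed.

Lemma sided_random_slopes_moments (G : bool -> Omega -> R) Y :
  (forall b, independent P Y (G b)) -> (forall b, G b \in L2) -> Y \in L2 ->
  let X w := sided_lin (fun b => G b w) (Y w) in
  [/\ X \in L2, Ex P X = sided_mean (fun b => Ex P (G b)) Y &
      Ex P (fun w => X w ^+ 2) = sided_sqmean (fun b => Ex P (fun w => G b w ^+ 2)) Y].
Proof.
move=> YG G2 Y2 X; have mY := Lfun_measurable Y2.
have YGsqr b : independent P Y (fun w => G b w ^+ 2).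
  exact: (independent_comp (@measurable_id _ _ setT) (@exprn_measurable R setT 2) (YG b)).
have [X1 EX] := independent_sided_ExM YG (fun b => Lfun2_Lfun1 (G2 b)) mY
  (@measurable_id _ _ setT) (Lfun2_Lfun1 Y2).
have [Xsqr1 EXsqr] := independent_sided_ExM YGsqr (fun b => Lfun2_sqr (G2 b)) mY
  (@exprn_measurable R setT 2) (Lfun2_sqr Y2).
have XsqrE : (fun w => X w ^+ 2) = fun w => G (0 <= Y w) w ^+ 2 * Y w ^+ 2.
  by apply/funext => w; rewrite exprMn.
split=> //; last by rewrite XsqrE.
apply/Lfun2P; split; first exact: Lfun_measurable X1.
by apply/Lfun1_integrable; rewrite XsqrE.
Qed.

End SidedMoments.

(** * Minimization of coercive functions *)

Section Coercivity.
Context {R : realType}.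

Lemma locally_lipschitz_continuous (V : normedModType R) (f : V -> R) :
  (forall x, exists L : R, forall y, `|x - y| <= 1 -> `|f x - f y| <= L * `|x - y|) ->
  continuous f.
Proof.
move=> flip x; have [L fL] := flip x; have L1 : 0 < `|L| + 1 by rewrite ltr_wpDl.
apply/cvgrPdist_le => e e0; near=> y.
have xy1 : `|x - y| <= 1 by near: y; exact: cvgr_dist_le.
have xye : `|x - y| <= e / (`|L| + 1).
  by near: y; apply: cvgr_dist_le => //; rewrite divr_gt0.
rewrite (le_trans (fL _ xy1))// (@le_trans _ _ ((`|L| + 1) * `|x - y|))//.
  by rewrite ler_wpM2r// (le_trans (ler_norm L))// lerDl.
by rewrite mulrC -ler_pdivlMr.
Unshelve. all: by end_near. Qed.

Context {n : nat}.
Implicit Types (f g : 'rV[R]_n -> R) (K : 'rV[R]_n).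

Lemma compact_norm_preimage (A : set R) (r : R) : closed A -> (forall x, A x -> x <= r) ->
  compact [set K : 'rV[R]_n | A `|K|].
Proof.
move=> Acl Ar; apply: bounded_closed_compact.
  by exists r; split=> [|x rx K /= /Ar Kr]; rewrite ?num_real// (le_trans Kr)// ltW.
by apply: (preimage_closed (f := fun K => `|K|)) => // K _; exact: norm_continuous.
Qed.

Lemma coercive_argmin f (c B D : R) : continuous f -> 0 < c ->
  (forall K, c * `|K| ^+ 2 - (B + D * `|K|) <= f K) -> exists K, is_argmin f K.
Proof.
move=> fc c0 fK; pose r := 1 + (`|f 0| + `|B| + `|D|) / c.
have r1 : 1 <= r by rewrite lerDl divr_ge0 ?addr_ge0// ltW.
have ball0 : (0 : 'rV[R]_n) \in [set K : 'rV[R]_n | `|K| <= r]%classic.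
  by rewrite inE/= normr0 (le_trans _ r1).
have [|||K Kr Kmin] := @EVT_min_rV _ _ f [set K : 'rV[R]_n | `|K| <= r]%classic.
- by exists 0; rewrite inE in ball0.
- by apply: (@compact_norm_preimage [set x | x <= r]%classic r) => //; exact: closed_le.
- exact: continuous_subspaceT.
exists K => K'; have [K'r|rK'] := leP `|K'| r; first by apply: Kmin; rewrite inE.
suff : f 0 <= f K' by exact: le_trans (Kmin _ ball0).
have K'1 : 1 <= `|K'| by rewrite (le_trans r1)// ltW.
have cK' : c + (`|f 0| + `|B| + `|D|) <= c * `|K'|.
  rewrite (_ : _ + _ = c * r) ?ler_pM2l ?(ltW rK')//.
  by rewrite /r mulrDr mulr1 mulrCA divff ?mulr1// gt_eqF.
have := fK K'; have := ler_norm (f 0); have := ler_norm B; have := ler_norm D.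
have := normr_ge0 (f 0); have := normr_ge0 B; have := normr_ge0 D.
move: `|K'| K'1 cK' => k k1 ck *.
have : c * k * k >= (c + (`|f 0| + `|B| + `|D|)) * k by rewrite ler_wpM2r// (le_trans _ k1).
nra.
Qed.

Lemma homogeneous_quadratic_growth g : continuous g ->
  (forall k K, 0 <= k -> g (k *: K) = k ^+ 2 * g K) -> (forall K, K != 0 -> 0 < g K) ->
  exists2 c : R, 0 < c & forall K, c * `|K| ^+ 2 <= g K.
Proof.
move=> gc g_hom g_pos; pose sphere := [set K : 'rV[R]_n | `|K| = 1]%classic.
have g0 : g 0 = 0 by rewrite -(scale0r (0 : 'rV[R]_n)) g_hom// expr0n mul0r.
suff [c c0 cg] : exists2 c : R, 0 < c & forall K, sphere K -> c <= g K.
  exists c => // K; have [->|K0] := eqVneq K 0; first by rewrite normr0 g0 expr0n mulr0.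
  rewrite -[K in leRHS](scalerKV (a := `|K|)) ?normr_eq0// g_hom// mulrC.
  rewrite ler_wpM2l ?sqr_ge0// cg// /sphere/= normrZ ger0_norm ?invr_ge0//.
  by rewrite mulVf// normr_eq0.
have [sphere0|no_sphere] := pselect (sphere !=set0)%classic; last first.
  by exists 1 => // K Ksphere; case: no_sphere; exists K.
have [||K Ksphere Kmin] := EVT_min_rV (f := g) sphere0.
- by apply: (@compact_norm_preimage [set x | x = 1]%classic 1) => [|x ->//]; exact: closed_eq.
- exact: continuous_subspaceT.
exists (g K) => [|K' K'sphere]; last by apply: Kmin; rewrite inE.
by apply: g_pos; rewrite -normr_eq0; move: Ksphere; rewrite inE/= => ->; rewrite oner_eq0.
Qed.

End Coercivity.

(** * One period *)

Section OnePeriod.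
Context {d : measure_display} {Omega : measurableType d} {R : realType}.
Variables (P : probability Omega R) (n : nat) (Pc : nat -> 'I_n -> Omega -> R).
Variable t : nat.
Hypothesis Pc2 : forall i, Pc t i \in Lfun P 2%:E.
Implicit Types K : 'rV[R]_n.
Local Notation L1 := (Lfun P 1).
Local Notation L2 := (Lfun P 2%:E).
Local Notation pK := (pK Pc t).

Lemma pKZ k K w : pK (k *: K) w = k * pK K w.
Proof. by rewrite /Defs.pK mulr_sumr; apply: eq_bigr => i _; rewrite mxE mulrCA. Qed.

Lemma pK0 w : pK 0 w = 0.
Proof. by rewrite -(scale0r (0 : 'rV[R]_n)) pKZ mul0r. Qed.

Lemma pKB K K' w : pK (K - K') w = pK K w - pK K' w.
Proof. by rewrite /Defs.pK -sumrB; apply: eq_bigr => i _; rewrite !mxE mulrBr. Qed.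

Let Lfun2_pK_term K i : (fun w => Pc t i w * K ord0 i) \in L2.
Proof.
rewrite (_ : (fun w => _) = K ord0 i *: Pc t i); first by rewrite rpredZ ?lee1n.
by apply/funext => w; rewrite mulrC.
Qed.

Lemma Lfun2_pK K : pK K \in L2.
Proof. by apply: Lfun_sum => //; exact: lee1n. Qed.

Lemma Lfun2_affine c K : (fun w => c + pK K w) \in L2.
Proof. exact: Lfun2D (Lfun_cst _ _ _) (Lfun2_pK K). Qed.

Lemma meanKE K : meanK P Pc t K = Ex P (pK K).
Proof.
rewrite /meanK /meanP mxE Ex_sum => [|i]; last exact/Lfun2_Lfun1/Lfun2_pK_term.
apply: eq_bigr => i _; rewrite !mxE mulrC -ExZ; last exact/Lfun2_Lfun1.
by apply: eq_Ex => w; rewrite mulrC.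
Qed.

Lemma quad_secondE K : quad (secondP P Pc t) K = Ex P (fun w => pK K w ^+ 2).
Proof.
have product_Lfun1 i j : (fun w => (Pc t i w * K ord0 i) * (Pc t j w * K ord0 j)) \in L1.
  exact: Lfun2_mul_Lfun1.
rewrite (eq_Ex (fun w => \sum_j \sum_i (Pc t i w * K ord0 i) * (Pc t j w * K ord0 j))); last first.
  by move=> w; rewrite expr2 mulr_sumr; apply: eq_bigr => j _; rewrite mulr_suml.
rewrite Ex_sum => [|j]; last exact: Lfun_sum.
rewrite /quad mxE; apply: eq_bigr => j _; rewrite Ex_sum// mxE mulr_suml.
apply: eq_bigr => i _; rewrite !mxE mulrAC -ExZ; last exact: Lfun2_mul_Lfun1.
by apply: eq_Ex => w; ring.
Qed.

Lemma quad_covE K : quad (covP P Pc t) K = Var P (pK K).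
Proof.
rewrite VarE; last exact: Lfun2_pK.
rewrite -quad_secondE -meanKE /quad /covP mulmxBr mulmxBl [LHS]mxE [X in _ + X]mxE.
congr (_ - _); rewrite mulmxA -mulmxA mxE big_ord1 expr2 /meanK.
by rewrite -[K in X in X * _ = _]trmxK -trmx_mul mxE.
Qed.

Local Notation Z := (fun c K w => c + pK K w).

Let envelope w := 1 + \sum_(i < n) `|Pc t i w|.

Let envelope_ge1 w : 1 <= envelope w.
Proof. by rewrite lerDl sumr_ge0. Qed.

Let Lfun2_envelope : envelope \in L2.
Proof.
apply: Lfun2D (Lfun_cst _ _ _) _.
by apply: Lfun_sum => [|i]; [exact: lee1n|exact: Lfun2_norm].
Qed.

Let norm_pK_le K w : `|pK K w| <= `|K| * envelope w.
Proof.
apply: (@le_trans _ _ (`|K| * \sum_i `|Pc t i w|)); last by rewrite ler_wpM2l// lerDr.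
rewrite (le_trans (ler_norm_sum _ _ _))// mulr_sumr ler_sum// => i _; rewrite normrM mulrC ler_wpM2r//.
rewrite [leRHS]/Num.norm/= mx_normrE.
exact: (le_bigmax _ (fun ij => `|K ij.1 ij.2|) (ord0, i)).
Qed.

Let affine_dist c c' K K' w : `|Z c K w - Z c' K' w| <= (`|c - c'| + `|K - K'|) * envelope w.
Proof.
rewrite (_ : _ - _ = (c - c') + pK (K - K') w); last by rewrite pKB; ring.
by rewrite (le_trans (ler_normD _ _))// mulrDl lerD// ler_peMr.
Qed.

Let norm_affine_le c K w : `|Z c K w| <= (`|c| + `|K|) * envelope w.
Proof. by have := affine_dist c 0 K 0 w; rewrite pK0 addr0 !subr0. Qed.

Section Minimizer.
Variables p q : bool -> R.

Let mean_lip := slope_bound p * Ex P envelope.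
Let var_lip := slope_bound q * Ex P (fun w => envelope w ^+ 2) + mean_lip ^+ 2.

Let mean_lip_ge0 : 0 <= mean_lip.
Proof.
by rewrite mulr_ge0 ?slope_bound_ge0// Ex_ge0// => w; rewrite (le_trans _ (envelope_ge1 w)).
Qed.

Let var_lip_ge0 : 0 <= var_lip.
Proof.
by rewrite addr_ge0 ?sqr_ge0// mulr_ge0 ?slope_bound_ge0// Ex_ge0// => w; exact: sqr_ge0.
Qed.

Let Ex_norm_le_envelope X e : X \in L2 -> (forall w, `|X w| <= e * envelope w) ->
  Ex P (fun w => `|X w|) <= e * Ex P envelope.
Proof.
move=> X2 Xe; rewrite -ExZ; last exact: Lfun2_Lfun1.
apply: le_Ex => //; first exact/Lfun_norm/Lfun2_Lfun1.
by apply: rpredZ; exact: Lfun2_Lfun1.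
Qed.

Lemma sided_mean_affine_dist c c' K K' :
  `|sided_mean P p (Z c K) - sided_mean P p (Z c' K')| <= mean_lip * (`|c - c'| + `|K - K'|).
Proof.
rewrite (le_trans (sided_mean_dist p (Lfun2_affine c K) (Lfun2_affine c' K')))// -mulrA.
rewrite ler_wpM2l ?slope_bound_ge0// mulrC.
apply: Ex_norm_le_envelope => [|w]; last exact: affine_dist.
by apply: Lfun2B; exact: Lfun2_affine.
Qed.

Lemma sided_var_affine_dist c c' K K' :
  `|sided_var P p q (Z c K) - sided_var P p q (Z c' K')| <=
  var_lip * ((`|c - c'| + `|K - K'|) * (`|c| + `|c'| + `|K| + `|K'|)).
Proof.
have [Z2 Z2'] := (Lfun2_affine c K, Lfun2_affine c' K').
rewrite (le_trans (sided_var_dist p q Z2 Z2'))// /var_lip [leRHS]mulrDl /mean_lip.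
set dist := `|c - c'| + _; set size := `|c| + _ + _ + _.
have size_split : size = (`|c| + `|K|) + (`|c'| + `|K'|) by rewrite /size; ring.
have dist_le w : `|Z c K w - Z c' K' w| <= dist * envelope w := affine_dist c c' K K' w.
have size_le w : `|Z c K w| + `|Z c' K' w| <= size * envelope w.
  by rewrite size_split mulrDl lerD// norm_affine_le.
have sqr_part : Ex P (fun w => `|Z c K w - Z c' K' w| * (`|Z c K w| + `|Z c' K' w|)) <=
    dist * size * Ex P (fun w => envelope w ^+ 2).
  rewrite -ExZ; last exact: Lfun2_sqr.
  apply: le_Ex => [||w]; last by rewrite expr2 mulrACA ler_pM.
    by apply: Lfun2_mul_Lfun1; [exact/Lfun2_norm/Lfun2B|apply: Lfun2D; exact: Lfun2_norm].
  by apply: rpredZ; exact: Lfun2_sqr.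
have mean_part : Ex P (fun w => `|Z c K w - Z c' K' w|) *
    (Ex P (fun w => `|Z c K w|) + Ex P (fun w => `|Z c' K' w|)) <=
    dist * size * Ex P envelope ^+ 2.
  rewrite expr2 mulrACA ler_pM ?addr_ge0 ?Ex_ge0//.
    by apply: Ex_norm_le_envelope dist_le; exact: Lfun2B.
  rewrite size_split mulrDl lerD//; apply: Ex_norm_le_envelope => // w; exact: norm_affine_le.
by rewrite exprMn lerD// -[leRHS]mulrA ler_wpM2l ?slope_bound_ge0 ?sqr_ge0// [leRHS]mulrC.
Qed.

Hypothesis cov_pos : forall K, K != 0 -> 0 < quad (covP P Pc t) K.
Hypothesis pq : forall b, nondegenerate (p b) (q b).

Lemma affine_ae_cst c K k : {ae P, forall w, c + pK K w = k} -> K = 0.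
Proof.
move=> Zk; apply: contrapT => /eqP/cov_pos; rewrite quad_covE.
rewrite (Var_ae_cst (k := k - c)) ?ltxx//; first exact: Lfun_measurable (Lfun2_pK K).
by apply: filterS Zk => w <-; rewrite addrC addKr.
Qed.

Lemma sided_var_affine_eq0 c K : sided_var P p q (Z c K) = 0 -> K = 0.
Proof. by move=> /(sided_var_eq0_ae_cst pq (Lfun2_affine c K)) [k]; exact: affine_ae_cst. Qed.

Lemma nondegenerate_affine c K : 0 < c ->
  nondegenerate (sided_mean P p (Z c K)) (sided_sqmean P q (Z c K)).
Proof.
move=> c0; split; first by rewrite -subr_ge0; exact: sided_var_ge0 pq (Lfun2_affine c K).
move=> meanE; have K0 : K = 0 by apply: (@sided_var_affine_eq0 c); rewrite /sided_var meanE subrr.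
have ZE : Z c K = fun=> c by apply/funext => w; rewrite K0 pK0 addr0.
move: meanE; rewrite ZE sided_mean_cst sided_sqmean_cst /sided_lin /sided_sqr ltW//.
rewrite exprMn => /(mulIf _) qp; rewrite mulr_gt0//.
by case: (pq true) => _; apply; apply: qp; rewrite sqrf_eq0 gt_eqF.
Qed.

Lemma sided_objective_continuous g c :
  continuous (fun K => sided_var P p q (Z c K) - g * sided_mean P p (Z c K)).
Proof.
apply: locally_lipschitz_continuous => K.
exists (var_lip * (2 * `|c| + 2 * `|K| + 1) + `|g| * mean_lip) => K' KK'1.
have var_dist := sided_var_affine_dist c c K K'.
have mean_dist := sided_mean_affine_dist c c K K'.
rewrite subrr normr0 add0r in var_dist mean_dist.
rewrite [X in `|X|](_ : _ = (sided_var P p q (Z c K) - sided_var P p q (Z c K')) -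
  g * (sided_mean P p (Z c K) - sided_mean P p (Z c K'))); last by ring.
rewrite (le_trans (ler_normB _ _))// [leRHS]mulrDl lerD//; last first.
  by rewrite normrM -mulrA ler_wpM2l.
rewrite (le_trans var_dist)// -mulrA ler_wpM2l// mulrC ler_wpM2r//.
have : `|K'| <= `|K| + `|K - K'| by rewrite -{1}(subKr K K') (le_trans (ler_normB _ _)).
by lra.
Qed.

Lemma sided_var_pK_growth :
  exists2 a : R, 0 < a & forall K, a * `|K| ^+ 2 <= sided_var P p q (pK K).
Proof.
have Z0 K : Z 0 K = pK K by apply/funext => w; rewrite add0r.
apply: homogeneous_quadratic_growth => [|k K k0|K K0].
- rewrite (_ : (fun K => _) = fun K => sided_var P p q (Z 0 K) - 0 * sided_mean P p (Z 0 K)).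
    exact: sided_objective_continuous.
  by apply/funext => K; rewrite mul0r subr0 Z0.
- rewrite (_ : pK _ = fun w => k * pK K w); last by apply/funext => w; exact: pKZ.
  by rewrite sided_varM ?k0//; exact: Lfun2_pK.
- rewrite lt_neqAle (sided_var_ge0 pq (Lfun2_pK K)) andbT.
  by apply: contra_neq K0 => /esym; rewrite -Z0; exact: sided_var_affine_eq0.
Qed.

Lemma sided_objective_argmin g c :
  exists K, is_argmin (fun K => sided_var P p q (Z c K) - g * sided_mean P p (Z c K)) K.
Proof.
have [a a0 growth] := sided_var_pK_growth.
apply: (@coercive_argmin _ _ _ a (var_lip * `|c| ^+ 2 + `|g| * mean_lip * `|c|)
   (2 * var_lip * `|c| + `|g| * mean_lip)) a0 _ => [|K].
  exact: sided_objective_continuous.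
have Z0 : Z 0 K = pK K by apply/funext => w; rewrite add0r.
have mean_le : g * sided_mean P p (Z c K) <= `|g| * (mean_lip * (`|c| + `|K|)).
  rewrite (le_trans (ler_norm _))// normrM ler_wpM2l//.
  have := sided_mean_affine_dist c 0 K 0.
  rewrite !subr0 (_ : Z 0 0 = fun=> 0); last by apply/funext => w; rewrite pK0 addr0.
  by rewrite sided_mean_cst [sided_lin p 0]mulr0 subr0.
have var_ge : sided_var P p q (pK K) - sided_var P p q (Z c K) <=
    var_lip * (`|c| * (`|c| + `|K| + `|K|)).
  have := sided_var_affine_dist c 0 K K; rewrite Z0 subrr subr0 !normr0 !addr0.
  by move=> dist; rewrite (le_trans _ dist)// distrC ler_norm.
by have := growth K; lra.
Qed.

End Minimizer.
End OnePeriod.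

(** * The recursion in terms of moments *)

Definition side {T : Type} (x y : T) (b : bool) : T := if b then x else y.

(* If the terminal wealth is [r * y] plus a gain with mean [a b * y] and second moment
   [q b * y ^+ 2], its mean and second moment are these multiples of [y] and [y ^+ 2]. *)
Definition mean_slope {R : realType} (r : R) (a : bool -> R) (b : bool) : R := r + a b.
Definition sqmean_slope {R : realType} (r : R) (a q : bool -> R) (b : bool) : R :=
  q b + 2 * r * a b + r ^+ 2.

Lemma sqmean_slope_sub {R : realType} (r : R) (a q : bool -> R) b :
  sqmean_slope r a q b - mean_slope r a b ^+ 2 = q b - a b ^+ 2.
Proof. by rewrite /sqmean_slope /mean_slope; ring. Qed.

Section RecursionStep.
Context {d : measure_display} {Omega : measurableType d} {R : realType}.
Variables (P : probability Omega R) (n : nat) (Pc : nat -> 'I_n -> Omega -> R).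
Variables (N : nat) (s : nat -> R) (t : nat).
Hypothesis Pc2 : forall i, Pc t i \in Lfun P 2%:E.
Variables (gp gm : nat -> R) (ap am bp bm : R) (K : 'rV[R]_n).
Local Notation pK := (pK Pc t K).
Local Notation Z := (Zt Pc s t K).
Local Notation r := (rho N s t.+1).
Local Notation alpha := (mean_slope r (side ap am)).
Local Notation second := (sqmean_slope r (side ap am) (side bp bm)).
Implicit Types p q : bool -> R.

Let Z2 : Z \in Lfun P 2%:E.
Proof. exact: Lfun2_affine. Qed.

Let Z1 : Z \in Lfun P 1.
Proof. exact: Lfun2_Lfun1. Qed.

Let mean_Z : Ex P Z = s t + Ex P pK.
Proof. by rewrite ExD ?Ex_cst//; [exact: Lfun_cst|exact/Lfun2_Lfun1/Lfun2_pK]. Qed.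

Let sqmean_Z : Ex P (fun w => Z w ^+ 2) =
  s t ^+ 2 + 2 * s t * Ex P pK + Ex P (fun w => pK w ^+ 2).
Proof.
have pK2 := Lfun2_pK Pc2 K; have := VarE Z2; rewrite mean_Z.
have <- : Var P pK = Var P Z by rewrite /Var varianceD_cst_l.
by rewrite VarE//; lra.
Qed.

Let sided_mean_alpha b : sided_mean P (mirror alpha b) Z =
  r * (s t + Ex P pK) + sided_mean P (mirror (side ap am) b) Z.
Proof.
rewrite -mean_Z -sided_mean_cst_slope// -[X in X + _]mul1r -sided_mean_linear//.
by apply: eq_Ex => w; rewrite /sided_lin mul1r.
Qed.

Let sided_sqmean_second b : sided_sqmean P (mirror second b) Z =
  sided_sqmean P (mirror (fun c => 2 * r * side ap am c + side bp bm c) b) Z +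
  r ^+ 2 * Ex P (fun w => Z w ^+ 2).
Proof.
rewrite -sided_sqmean_cst_slope// -[X in X + _]mul1r -sided_sqmean_linear//.
by apply: eq_Ex => w; rewrite /sided_sqr mul1r /mirror /sqmean_slope; ring.
Qed.

Let sided_sqmean_gain b :
  sided_sqmean P (mirror (fun c => 2 * r * side ap am c + side bp bm c) b) Z =
  2 * r * sided_sqmean P (mirror (side ap am) b) Z + sided_sqmean P (mirror (side bp bm) b) Z.
Proof. exact: sided_sqmean_linear. Qed.

Let sided_sqmean_cross p : sided_sqmean P p Z =
  s t * sided_mean P p Z + Ex P (fun w => p (0 <= Z w) * Z w * pK w).
Proof.
have lin1 := Lfun1_sided_lin p Z1; rewrite -ExZ// -ExD.
- by apply: eq_Ex => w; rewrite /sided_sqr /sided_lin /Zt; ring.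
- exact: rpredZ.
- by apply: Lfun2_mul_Lfun1; [exact: Lfun2_sided_lin|exact: Lfun2_pK].
Qed.

Let slopeZ_Lfun1 p b : (fun w => p b * Z w) \in Lfun P 1.
Proof. exact: rpredZ. Qed.

Let slopeZsqr_Lfun1 p b : (fun w => p b * Z w ^+ 2) \in Lfun P 1.
Proof. by apply: rpredZ; exact: Lfun2_sqr. Qed.

Let slopeZpK_Lfun1 p b : (fun w => p b * Z w * pK w) \in Lfun P 1.
Proof. by apply: Lfun2_mul_Lfun1; [rewrite rpredZ ?lee1n|exact: Lfun2_pK]. Qed.

Let mZ : measurable_fun setT Z.
Proof. exact: Lfun_measurable Z2. Qed.

Let plus_mean p : sided_mean P p Z =
  Ex P (fun w => if 0 <= Z w then p true * Z w else 0) +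
  Ex P (fun w => if Z w < 0 then p false * Z w else 0).
Proof. exact: Ex_split_ge mZ (slopeZ_Lfun1 p). Qed.

Let plus_sqmean q : sided_sqmean P q Z =
  Ex P (fun w => if 0 <= Z w then q true * Z w ^+ 2 else 0) +
  Ex P (fun w => if Z w < 0 then q false * Z w ^+ 2 else 0).
Proof. exact: Ex_split_ge mZ (slopeZsqr_Lfun1 q). Qed.

Let plus_cross p : Ex P (fun w => p (0 <= Z w) * Z w * pK w) =
  Ex P (fun w => if 0 <= Z w then p true * Z w * pK w else 0) +
  Ex P (fun w => if Z w < 0 then p false * Z w * pK w else 0).
Proof. exact: Ex_split_ge mZ (slopeZpK_Lfun1 p). Qed.

Let mirror_false p w x : (Z w = 0 -> x = 0) ->
  p (Z w <= 0) * x = mirror p false (0 <= Z w) * x.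
Proof. by rewrite /mirror; case: ltgtP => //= -> ->//; rewrite !mulr0. Qed.

Let minus_mean p : sided_mean P (mirror p false) Z =
  Ex P (fun w => if Z w <= 0 then p true * Z w else 0) +
  Ex P (fun w => if 0 < Z w then p false * Z w else 0).
Proof. by rewrite -(Ex_split_le mZ (slopeZ_Lfun1 p)); apply: eq_Ex => w; rewrite mirror_false. Qed.

Let minus_sqmean q : sided_sqmean P (mirror q false) Z =
  Ex P (fun w => if Z w <= 0 then q true * Z w ^+ 2 else 0) +
  Ex P (fun w => if 0 < Z w then q false * Z w ^+ 2 else 0).
Proof.
rewrite -(Ex_split_le mZ (slopeZsqr_Lfun1 q)); apply: eq_Ex => w.
by rewrite mirror_false// => ->; rewrite expr0n.
Qed.

Let minus_cross p : Ex P (fun w => mirror p false (0 <= Z w) * Z w * pK w) =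
  Ex P (fun w => if Z w <= 0 then p true * Z w * pK w else 0) +
  Ex P (fun w => if 0 < Z w then p false * Z w * pK w else 0).
Proof.
by rewrite -(Ex_split_le mZ (slopeZpK_Lfun1 p)); apply: eq_Ex => w; rewrite mirror_false.
Qed.

Lemma a_sideE b :
  mean_slope (r * s t) (side (a_plus P Pc N s t ap am K) (a_minus P Pc N s t ap am K)) b =
  sided_mean P (mirror alpha b) Z.
Proof.
rewrite sided_mean_alpha /mean_slope; case: b => /=.
- by rewrite /a_plus meanKE// [sided_mean _ _ _]plus_mean; ring.
- by rewrite /a_minus meanKE// minus_mean; ring.
Qed.

Lemma b_sideE b :
  sqmean_slope (r * s t) (side (a_plus P Pc N s t ap am K) (a_minus P Pc N s t ap am K))
    (side (b_plus P Pc N s t ap am bp bm K) (b_minus P Pc N s t ap am bp bm K)) b =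
  sided_sqmean P (mirror second b) Z.
Proof.
rewrite sided_sqmean_second sided_sqmean_gain (sided_sqmean_cross (mirror _ b)) sqmean_Z.
rewrite /sqmean_slope; case: b => /=.
- rewrite /a_plus /b_plus meanKE// quad_secondE//.
  by rewrite [sided_mean _ _ _]plus_mean [sided_sqmean _ _ _]plus_sqmean plus_cross; ring.
- rewrite /a_minus /b_minus meanKE// quad_secondE//.
  by rewrite minus_mean minus_sqmean minus_cross; ring.
Qed.

Lemma F_sideE b :
  side (Fplus P Pc N s gp t ap am bp bm K) (Fminus P Pc N s gm t ap am bp bm K) b =
  sided_var P (mirror alpha b) (mirror second b) Z -
    side (gp t) (- gm t) b * sided_mean P (mirror alpha b) Z.
Proof.
rewrite /sided_var sided_mean_alpha sided_sqmean_second sqmean_Z; case: b => /=.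
- rewrite /Fplus /Mplus quad_covE// VarE ?Lfun2_pK// meanKE//.
  by rewrite [sided_mean _ _ _]plus_mean [sided_sqmean _ _ _]plus_sqmean; ring.
- rewrite /Fminus /Mminus quad_covE// VarE ?Lfun2_pK// meanKE//.
  by rewrite minus_mean minus_sqmean; ring.
Qed.

End RecursionStep.

(** * Terminal wealth *)

Section Wealth.
Context {d : measure_display} {Omega : measurableType d} {R : realType}.
Variables (P : probability Omega R) (n : nat) (Pc : nat -> 'I_n -> Omega -> R).
Variables (N : nat) (s : nat -> R) (W : R).
Hypothesis s_gt0 : forall t, (t < N)%N -> 0 < s t.
Local Notation rho := (rho N s).
Local Notation lvl := (lvl N s W).
Local Notation L2 := (Lfun P 2%:E).

Lemma rho_rec t : (t < N)%N -> rho t = rho t.+1 * s t.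
Proof. by move=> tN; rewrite /Defs.rho big_ltn// mulrC. Qed.

Lemma rho_end : rho N = 1.
Proof. by rewrite /Defs.rho big_geq. Qed.

Lemma rho_gt0 t : 0 < rho t.
Proof.
rewrite /Defs.rho big_nat_cond prodr_gt0// => j; rewrite andbT => /andP[_ jN].
exact: s_gt0.
Qed.

Lemma rho_lvl t : rho t * lvl t = W.
Proof. by rewrite /Defs.lvl mulrA mulfV ?mul1r// gt_eqF// rho_gt0. Qed.

Lemma lvl_rec t : (t < N)%N -> s t * lvl t = lvl t.+1.
Proof.
move=> tN; apply: (mulfI (lt0r_neq0 (rho_gt0 t.+1))).
by rewrite mulrA -rho_rec// !rho_lvl.
Qed.

Lemma lvl_end : lvl N = W.
Proof. by rewrite -[RHS](rho_lvl N) rho_end mul1r. Qed.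

Variables Kp Km : nat -> 'rV[R]_n.
Local Notation pol := (uTC N s W Kp Km).
Local Notation Zside b t := (Zt Pc s t (side (Kp t) (Km t) b)).

(* Ratio of the terminal deviation [X_N - W] to the deviation [X_t - lvl t] under [uTC],
   [m] periods before the end, for a deviation that is nonnegative ([b = true]) or negative. *)
Fixpoint growth (b : bool) (t m : nat) (w : Omega) : R :=
  if m is m'.+1 then
    sided_lin (mirror (fun c => growth c t.+1 m' w) b) (Zside b t w)
  else 1.

Lemma run_growth m t (X : Omega -> R) w : (t + m = N)%N ->
  run Pc s pol t m X w = W + sided_lin (fun b => growth b t m w) (X w - lvl t).
Proof.
elim: m t X => [|m IH] t X.
  by rewrite addn0 => ->; rewrite /sided_lin/= lvl_end mul1r addrC subrK.
rewrite addnS => tmN; have tN : (t < N)%N by rewrite -tmN ltnS leq_addr.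
rewrite /= IH ?addSn//; congr (W + _).
rewrite -lvl_rec// /uTC -subr_ge0 [RHS]mulrC; set y := X w - lvl t.
rewrite -sided_linM; congr sided_lin; rewrite (fun_if (fun u => Defs.pK Pc t u w)) !pKZ /Zt.
by case: (0 <= y); rewrite /y/=; ring.
Qed.

Hypothesis Pc2 : forall t i, (t < N)%N -> Pc t i \in L2.
Hypothesis indep : indep_returns P Pc N.

Lemma growth_future m b t : (t + m = N)%N ->
  measurable_fun setT (growth b t m : g_sigma_algebraType (future_events Pc N t) -> R).
Proof.
elim: m b t => [|m IH] b t; first by move=> _; exact: measurable_cst.
rewrite addnS => tmN; have tN : (t < N)%N by rewrite -tmN ltnS leq_addr.
have mgrowth c : measurable_fun setT
    (growth c t.+1 m : g_sigma_algebraType (future_events Pc N t) -> R).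
  apply: (@g_sigma_algebra_measurable_funS _ _ _ (future_events Pc N t.+1)); last first.
    by apply: IH; rewrite addSn.
  by move=> A tA; apply: sub_sigma_algebra; exact: future_events_le tA.
have mZ : measurable_fun setT (Zside b t : g_sigma_algebraType (future_events Pc N t) -> R).
  apply: measurable_funD => //.
  apply: (@g_sigma_algebra_measurable_funS _ _ _ (return_events Pc t)); last exact: measurable_pK.
  by move=> A tA; apply: sub_sigma_algebra; exact: return_events_future.
rewrite (_ : growth b t m.+1 = fun w => (if 0 <= Zside b t w
    then growth (b == true) t.+1 m w else growth (b == false) t.+1 m w) * Zside b t w).
  apply: measurable_funM => //; apply: measurable_fun_ifT => //.
  exact: measurable_fun_ler.
by apply/funext => w; rewrite /= /sided_lin /mirror; case: (0 <= _).
Qed.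

Lemma growth_independent b t m c K : (t + m.+1 = N)%N ->
  independent P (fun w => c + pK Pc t K w) (growth b t.+1 m).
Proof.
rewrite addnS => tmN; have tN : (t < N)%N by rewrite -tmN ltnS leq_addr.
have mPc u i : (u < N)%N -> measurable_fun setT (Pc u i).
  by move=> uN; exact: Lfun_measurable (Pc2 i uN).
apply: (independent_future mPc indep tN); last by apply: growth_future; rewrite addSn.
by apply: measurable_funD => //; exact: measurable_pK.
Qed.

Section Moments.
Variables (t0 : nat) (gp gm ap am bp bm : nat -> R).
Hypothesis rec : recursion_from P Pc N s gp gm t0 Kp Km ap am bp bm.

Definition alpha t := mean_slope (rho t) (side (ap t) (am t)).
Definition second t := sqmean_slope (rho t) (side (ap t) (am t)) (side (bp t) (bm t)).

Lemma alpha_end b : alpha N b = 1.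
Proof.
case: rec => apN amN _ _ _; rewrite /alpha /mean_slope apN amN rho_end.
by case: b; rewrite addr0.
Qed.

Lemma second_end b : second N b = 1.
Proof.
case: rec => apN amN bpN bmN _; rewrite /second /sqmean_slope apN amN bpN bmN rho_end.
by case: b; rewrite mulr0 !add0r expr1n.
Qed.

Lemma moments_rec b t : (t0 <= t < N)%N ->
  alpha t b = sided_mean P (mirror (alpha t.+1) b) (Zside b t) /\
  second t b = sided_sqmean P (mirror (second t.+1) b) (Zside b t).
Proof.
move=> /[dup] t0tN /andP[_ tN]; have [_ _ _ _ /(_ t t0tN) [_ _ [apE amE bpE bmE]]] := rec.
have Pct2 i := @Pc2 t i tN; rewrite /alpha /second rho_rec//.
have aE := a_sideE N s Pct2 (ap t.+1) (am t.+1).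
have bE := b_sideE N s Pct2 (ap t.+1) (am t.+1) (bp t.+1) (bm t.+1).
case: b; split; rewrite -?aE -?bE /mean_slope /sqmean_slope/=.
- by rewrite -apE.
- by rewrite -apE -bpE.
- by rewrite -amE.
- by rewrite -amE -bmE.
Qed.

Lemma growth_moments m t b : (t + m = N)%N -> (t0 <= t)%N ->
  [/\ growth b t m \in L2, Ex P (growth b t m) = alpha t b &
      Ex P (fun w => growth b t m w ^+ 2) = second t b].
Proof.
elim: m t b => [|m IH] t b.
  rewrite addn0 => -> _; rewrite alpha_end second_end.
  split; [exact: Lfun_cst|exact: Ex_cst|].
  by rewrite -[RHS](Ex_cst P); apply: eq_Ex => w; rewrite expr1n.
move=> tmN t0t; have tN : (t < N)%N by rewrite -tmN addnS ltnS leq_addr.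
have {}IH c := IH t.+1 c (etrans (addSnnS t m) tmN) (leqW t0t).
have [alphaE secondE] := moments_rec b (introT andP (conj t0t tN)).
have [||| X2 EX EXsqr] := @sided_random_slopes_moments _ _ _ P
  (mirror (fun c => growth c t.+1 m) b) (Zside b t).
- by move=> c; exact: growth_independent.
- by move=> c; have [] := IH (b == c).
- by apply: Lfun2_affine => i; exact: Pc2.
split=> //; [apply: etrans EX _; rewrite alphaE|apply: etrans EXsqr _; rewrite secondE].
- by apply: eq_Ex => w; congr (_ * _); have [_ ->] := IH (b == (0 <= Zside b t w)).
- by apply: eq_Ex => w; congr (_ * _); have [_ _ ->] := IH (b == (0 <= Zside b t w)).
Qed.

Lemma run_moments t m X : (t + m = N)%N -> (t0 <= t)%N ->
  (fun w => X w - lvl t) \in L2 ->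
  (forall b, independent P (fun w => X w - lvl t) (growth b t m)) ->
  'E_P[run Pc s pol t m X]%E = (W + sided_mean P (alpha t) (fun w => X w - lvl t))%:E /\
  'V_P[run Pc s pol t m X]%E = (sided_var P (alpha t) (second t) (fun w => X w - lvl t))%:E.
Proof.
move=> tmN t0t Y2 YG; set Y := fun w => X w - lvl t in Y2 YG *.
have growthE b := growth_moments b tmN t0t.
have [|G2 EG EGsqr] := sided_random_slopes_moments YG _ Y2.
  by move=> b; have [] := growthE b.
have runE : run Pc s pol t m X = cst W \+ (fun w => sided_lin (fun b => growth b t m w) (Y w)).
  by apply/funext => w; exact: run_growth.
have alphaE : (fun b => Ex P (growth b t m)) = alpha t.
  by apply/funext => b; have [] := growthE b.
have secondE : (fun b => Ex P (fun w => growth b t m w ^+ 2)) = second t.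
  by apply/funext => b; have [] := growthE b.
rewrite alphaE in EG; rewrite secondE in EGsqr; rewrite runE; split.
- by rewrite expectationD ?Lfun_cst ?Lfun2_Lfun1// expectation_cst expectation_Ex ?EG ?Lfun2_Lfun1.
- by rewrite varianceD_cst_l// variance_Var// VarE// EG EGsqr.
Qed.

Hypothesis cov_pos : forall t, (t < N)%N -> forall K, K != 0 -> 0 < quad (covP P Pc t) K.

Lemma nondegenerate_moments m t b : (t + m = N)%N -> (t0 <= t)%N ->
  nondegenerate (alpha t b) (second t b).
Proof.
elim: m t b => [|m IH] t b.
  by rewrite addn0 => -> _; rewrite alpha_end second_end; split; rewrite ?expr1n.
move=> tmN t0t; have tN : (t < N)%N by rewrite -tmN addnS ltnS leq_addr.
have [-> ->] := moments_rec b (introT andP (conj t0t tN)).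
apply: nondegenerate_affine => [i||c|]; [exact: Pc2|exact: cov_pos| |exact: s_gt0].
by apply: IH; [rewrite addSnnS|exact: leqW].
Qed.

Lemma F_argmin_exists t b : (t < N)%N -> (t0 <= t.+1)%N ->
  exists K, is_argmin (fun K =>
    side (Fplus P Pc N s gp t (ap t.+1) (am t.+1) (bp t.+1) (bm t.+1) K)
         (Fminus P Pc N s gm t (ap t.+1) (am t.+1) (bp t.+1) (bm t.+1) K) b) K.
Proof.
move=> tN t0t; have Pct2 i := @Pc2 t i tN.
have nondeg c := nondegenerate_moments (b == c) (subnKC tN) t0t.
have [K Kmin] := sided_objective_argmin Pct2 (cov_pos tN) nondeg (side (gp t) (- gm t) b) (s t).
by exists K => K'; rewrite !F_sideE//; exact: Kmin.
Qed.

End Moments.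
End Wealth.

(** * Time consistency *)

Section TimeConsistency.
Context {d : measure_display} {Omega : measurableType d} {R : realType}.
Variables (P : probability Omega R) (n : nat) (Pc : nat -> 'I_n -> Omega -> R).
Variables (N : nat) (s : nat -> R) (W : R) (gp gm : nat -> R).
Hypothesis s_gt0 : forall t, (t < N)%N -> 0 < s t.
Hypothesis Pc2 : forall t i, (t < N)%N -> Pc t i \in Lfun P 2%:E.
Hypothesis indep : indep_returns P Pc N.
Variables (Kp Km : nat -> 'rV[R]_n) (ap am bp bm : nat -> R).
Hypothesis rec : recursion_from P Pc N s gp gm 0 Kp Km ap am bp bm.
Local Notation lvl := (lvl N s W).
Local Notation pol := (uTC N s W Kp Km).
Local Notation obj := (nested_obj P Pc N s W gp gm pol).
Local Notation alpha := (alpha N s ap am).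
Local Notation second := (second N s ap am bp bm).

Lemma uTCE t x : pol t x = (x - lvl t) *: side (Kp t) (Km t) (0 <= x - lvl t).
Proof. by rewrite /uTC subr_ge0; case: ifP. Qed.

Lemma gamE t x : gam N s W gp gm t x = side (gp t) (- gm t) (0 <= x - lvl t) * (x - lvl t).
Proof. by rewrite /gam subr_ge0; case: ifP => //= _; rewrite mulNr. Qed.

Lemma XT_from_moments t x u : (t < N)%N ->
  let Y w := s t * (x - lvl t) + pK Pc t u w in
  'E_P[XT_from Pc N s pol t x u]%E = (W + sided_mean P (alpha t.+1) Y)%:E /\
  'V_P[XT_from Pc N s pol t x u]%E = (sided_var P (alpha t.+1) (second t.+1) Y)%:E.
Proof.
move=> tN Y; have YE : Y = fun w => s t * x + pK Pc t u w - lvl t.+1.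
  by apply/funext => w; rewrite -(lvl_rec W s_gt0 tN) /Y; ring.
rewrite YE; apply: (run_moments s_gt0 Pc2 indep rec (subnKC tN)) => //; rewrite -YE.
  by apply: Lfun2_affine => i; exact: Pc2.
by move=> b; apply: growth_independent => //; rewrite addnS -addSn subnKC.
Qed.

Lemma nested_obj_scale t x K : (t < N)%N -> let y := x - lvl t in
  obj t x (y *: K) =
  (y ^+ 2 * side (Fplus P Pc N s gp t (ap t.+1) (am t.+1) (bp t.+1) (bm t.+1) K)
              (Fminus P Pc N s gm t (ap t.+1) (am t.+1) (bp t.+1) (bm t.+1) K) (0 <= y)
   - side (gp t) (- gm t) (0 <= y) * y * W)%:E.
Proof.
move=> tN y; have Pct2 i := @Pc2 t i tN.
have Z2 : Zt Pc s t K \in Lfun P 2%:E by exact: Lfun2_affine.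
have [mean var] := XT_from_moments x (y *: K) tN.
rewrite /nested_obj mean var gamE -/y F_sideE//.
rewrite (_ : (fun w => _) = fun w => y * Zt Pc s t K w); last first.
  by apply/funext => w; rewrite pKZ /Zt; ring.
rewrite sided_varM// sided_meanM ?Lfun2_Lfun1// -EFinM -EFinB; congr EFin.
by ring.
Qed.

Lemma uTC_time_consistent : time_consistent P Pc N s W gp gm pol.
Proof.
move=> t tN x u; have [_ _ _ _ /(_ t) recs] := rec; have [Kpmin Kmmin _] := recs tN.
rewrite uTCE; have [y0|y0] := eqVneq (x - lvl t) 0.
  have [_ var] := XT_from_moments x 0 tN.
  rewrite /nested_obj gamE y0 mulr0 !mul0e !sube0 scale0r var y0.
  rewrite (_ : (fun w => _) = fun=> 0); last by apply/funext => w; rewrite pK0 mulr0 addr0.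
  rewrite /sided_var sided_mean_cst sided_sqmean_cst.
  by rewrite [sided_lin _ 0]mulr0 /sided_sqr expr0n mulr0 subr0 variance_ge0.
rewrite -[u in leRHS](scalerKV y0) !nested_obj_scale// lee_fin lerB// ler_wpM2l ?sqr_ge0//.
by case: (0 <= _) => /=.
Qed.

Lemma XT_moments x0 : let y := x0 - lvl 0 in
  'E_P[XT Pc N s pol x0]%E = (W + alpha 0 (0 <= y) * y)%:E /\
  'V_P[XT Pc N s pol x0]%E = ((second 0 (0 <= y) - alpha 0 (0 <= y) ^+ 2) * y ^+ 2)%:E.
Proof.
move=> y; have [||mean var] :=
  run_moments (W := W) s_gt0 Pc2 indep rec (add0n N) (leq0n 0) (X := cst x0).
- exact: (@Lfun_cst _ _ _ P (x0 - lvl 0) 2).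
- by move=> b; exact: (@independent_cst _ _ _ P (x0 - lvl 0)).
rewrite -/y in mean var; rewrite /XT mean var /sided_var sided_mean_cst sided_sqmean_cst.
by split=> //; congr EFin; rewrite /sided_lin /sided_sqr; ring.
Qed.

End TimeConsistency.

Theorem theorem1 (d : measure_display) (Omega : measurableType d) (R : realType)
  (P : probability Omega R) (n : nat) (Pc : nat -> 'I_n -> Omega -> R)
  (N : nat) (s : nat -> R) (W : R) (gp gm : nat -> R) :
  market_assumptions P Pc N s ->
  (forall t, (t < N)%N -> 0 <= gp t /\ 0 <= gm t) ->
  (* well-definedness: the minimizers exist at every step *)
  (forall t, (t < N)%N -> forall Kp Km ap am bp bm,
     recursion_from P Pc N s gp gm t.+1 Kp Km ap am bp bm ->
     (exists K, is_argmin (Fplus P Pc N s gp t (ap t.+1) (am t.+1) (bp t.+1) (bm t.+1)) K) /\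
     (exists K, is_argmin (Fminus P Pc N s gm t (ap t.+1) (am t.+1) (bp t.+1) (bm t.+1)) K)) /\
  (forall Kp Km ap am bp bm,
     recursion_from P Pc N s gp gm 0 Kp Km ap am bp bm ->
     [/\ forall t, (t <= N)%N -> 0 <= bp t - ap t ^+ 2 /\ 0 <= bm t - am t ^+ 2,
         time_consistent P Pc N s W gp gm (uTC N s W Kp Km) &
         forall x0 : R,
           let pol := uTC N s W Kp Km in
           let c := lvl N s W 0%N in
           'E_P[XT Pc N s pol x0]%E =
             (rho N s 0%N * x0 + (if c <= x0 then ap 0%N * (x0 - c) else am 0%N * (x0 - c)))%:E /\
           'V_P[XT Pc N s pol x0]%E =
             ((if c <= x0 then bp 0%N - ap 0%N ^+ 2 else bm 0%N - am 0%N ^+ 2) * (x0 - c) ^+ 2)%:E]).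
Proof.
move=> [s_gt1 mPc intPc indep [_ cov_pos _]] _.
have s_gt0 t : (t < N)%N -> 0 < s t by move=> /s_gt1; exact: lt_trans.
have Pc2 t i : (t < N)%N -> Pc t i \in Lfun P 2%:E.
  by move=> tN; apply/Lfun2P; split; [exact: mPc|case: (intPc t i tN)].
split=> [t tN Kp Km ap am bp bm rec|Kp Km ap am bp bm rec].
  have argmin b := F_argmin_exists s_gt0 Pc2 rec cov_pos b tN (leqnn t.+1).
  by split; [exact: (argmin true)|exact: (argmin false)].
split=> [t tN||x0 /=].
- have nonneg b : 0 <= side (bp t) (bm t) b - side (ap t) (am t) b ^+ 2.
    rewrite -(sqmean_slope_sub (rho N s t)) subr_ge0.
    by case: (nondegenerate_moments s_gt0 Pc2 rec cov_pos b (subnKC tN) (leq0n t)).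
  by split; [exact: (nonneg true)|exact: (nonneg false)].
- exact: (uTC_time_consistent W s_gt0 Pc2 indep rec).
- have [-> ->] := XT_moments W s_gt0 Pc2 indep rec x0.
  rewrite sqmean_slope_sub subr_ge0 /alpha /mean_slope; have := rho_lvl W s_gt0 0.
  set c := lvl N s W 0 => <-.
  by split; case: ifP => _; congr EFin; rewrite /=; ring.
Qed.
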